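(* Let $p\ge5$ be a prime with Legendre symbol $\left(\frac{-18}{p}\right)=-1$, and let $m\ge0$, $\alpha\ge0$, $n\ge0$ be integers. Then for every integer $i$ with $1\le i\le p-1$, $$\overline{S}_3^{\,8m+1}\big(48p^{2\alpha+2}n+2(24i+11p)p^{2\alpha+1}\big)\equiv0\pmod{16}.$$
   Context: For $|q|<1$ and a positive integer $k$, write $f_k=\prod_{j\ge1}(1-q^{kj})$. For a positive integer $r$, $\overline{S}_3^{\,r}(n)$ (number of $3$-Schur overpartitions of $n$ with $r$-tuples) is defined by $\sum_{n\ge0}\overline{S}_3^{\,r}(n)q^n=\prod_{n\ge1}\frac{(1+q^{2n-1})^r(1-q^{3(2n-1)})^r}{(1+q^{3(2n-1)})^r(1-q^{2n-1})^r}=\frac{f_2^{3r}f_3^{2r}f_{12}^r}{f_1^{2r}f_4^rf_6^{3r}}$. *)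

(* Defs.v *)
From HB Require Import structures.
From mathcomp Require Import all_boot all_order all_algebra.
From mathcomp Require Import boolp.

Set Implicit Arguments.
Unset Strict Implicit.
Unset Printing Implicit Defensive.

Import GRing.Theory.
Local Open Scope ring_scope.

Record fps (R : Type) := Fps { coefs : nat -> R }.

HB.instance Definition _ (R : Type) := gen_eqMixin (fps R).
HB.instance Definition _ (R : Type) := gen_choiceMixin (fps R).

Lemma fpsP (R : Type) (f g : fps R) :
  (forall n, coefs f n = coefs g n) -> f = g.
Proof. by case: f g => [f] [g] /= /funext ->. Qed.

Section Ring.
Variable R : comUnitRingType.
Implicit Types f g h : fps R.

Definition fps_zero : fps R := Fps (fun _ => 0).
Definition fps_opp f : fps R := Fps (fun n => - coefs f n).
Definition fps_add f g : fps R := Fps (fun n => coefs f n + coefs g n).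

Fact fps_addA : associative fps_add.
Proof. by move=> f g h; apply: fpsP => n /=; rewrite addrA. Qed.
Fact fps_addC : commutative fps_add.
Proof. by move=> f g; apply: fpsP => n /=; rewrite addrC. Qed.
Fact fps_add0 : left_id fps_zero fps_add.
Proof. by move=> f; apply: fpsP => n /=; rewrite add0r. Qed.
Fact fps_addN : left_inverse fps_zero fps_opp fps_add.
Proof. by move=> f; apply: fpsP => n /=; rewrite addNr. Qed.

HB.instance Definition _ :=
  GRing.isZmodule.Build (fps R) fps_addA fps_addC fps_add0 fps_addN.

Definition fps_one : fps R := Fps (fun n => (n == 0)%:R).
Definition fps_mul f g : fps R :=
  Fps (fun n => \sum_(i < n.+1) coefs f i * coefs g (n - i)).

Definition trunc_fps N f : {poly R} := \poly_(i < N) coefs f i.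

Lemma coefs_mul_poly f g (p q : {poly R}) n :
  (forall i, (i <= n)%N -> p`_i = coefs f i) ->
  (forall i, (i <= n)%N -> q`_i = coefs g i) ->
  (p * q)`_n = coefs (fps_mul f g) n.
Proof.
move=> pf qg; rewrite coefM; apply: eq_bigr => i _.
by rewrite pf ?qg ?leq_subr // -ltnS.
Qed.

Lemma coef_trunc N f i : (i < N)%N -> (trunc_fps N f)`_i = coefs f i.
Proof. by move=> iN; rewrite coef_poly iN. Qed.

Fact fps_mulA : associative fps_mul.
Proof.
move=> f g h; apply: fpsP => n.
have T k i : (i <= n)%N -> (trunc_fps n.+1 k)`_i = coefs k i.
  by move=> le_in; rewrite coef_trunc.
pose t := trunc_fps n.+1.
rewrite -(@coefs_mul_poly _ _ (t f) (t g * t h)) ?mulrA.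
- apply: coefs_mul_poly => // i le_in; last exact: T.
  by apply: coefs_mul_poly => j le_ji; apply: T; apply: leq_trans le_in.
- by move=> i; apply: T.
- move=> i le_in.
  by apply: coefs_mul_poly => j le_ji; apply: T; apply: leq_trans le_in.
Qed.

Fact fps_mulC : commutative fps_mul.
Proof.
move=> f g; apply: fpsP => n; pose t := trunc_fps n.+1.
have T k i : (i <= n)%N -> (t k)`_i = coefs k i.
  by move=> le_in; rewrite coef_trunc.
by rewrite -(coefs_mul_poly (T f) (T g)) mulrC; apply: coefs_mul_poly; apply: T.
Qed.

Fact fps_mul1 : left_id fps_one fps_mul.
Proof.
move=> f; apply: fpsP => n /=.
by rewrite big_ord_recl /= mul1r subn0 big1 ?addr0 // => i _; rewrite mul0r.
Qed.

Fact fps_mulD : left_distributive fps_mul fps_add.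
Proof.
move=> f g h; apply: fpsP => n /=.
by rewrite -big_split; apply: eq_bigr => i _; rewrite mulrDl.
Qed.

Fact fps_1neq0 : fps_one != 0.
Proof.
by apply/eqP => /(congr1 (fun f => coefs f 0)) /= /eqP; rewrite oner_eq0.
Qed.

HB.instance Definition _ := GRing.Zmodule_isComNzRing.Build (fps R)
  fps_mulA fps_mulC fps_mul1 fps_mulD fps_1neq0.

Lemma coefs0 n : coefs (0 : fps R) n = 0. Proof. by []. Qed.
Lemma coefs1 n : coefs (1 : fps R) n = (n == 0)%:R. Proof. by []. Qed.
Lemma coefsN f n : coefs (- f) n = - coefs f n. Proof. by []. Qed.
Lemma coefsD f g n : coefs (f + g) n = coefs f n + coefs g n.
Proof. by []. Qed.
Lemma coefsB f g n : coefs (f - g) n = coefs f n - coefs g n.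
Proof. by []. Qed.
Lemma coefsM f g n :
  coefs (f * g) n = \sum_(i < n.+1) coefs f i * coefs g (n - i).
Proof. by []. Qed.
Lemma coefs_sum I (r : seq I) (P : pred I) (F : I -> fps R) n :
  coefs (\sum_(i <- r | P i) F i) n = \sum_(i <- r | P i) coefs (F i) n.
Proof. by apply: (big_morph (fun f => coefs f n)). Qed.

Definition fps_const (c : R) : fps R := Fps (fun n => c *+ (n == 0)).

Lemma coefs_constM c f n : coefs (fps_const c * f) n = c * coefs f n.
Proof.
rewrite coefsM big_ord_recl /= subn0 big1 ?addr0 // => i _.
by rewrite mul0r.
Qed.

(* [eq1_below a f] means f = 1 + O(q^a). *)
Definition eq1_below a f :=
  forall n, (n < a)%N -> coefs f n = coefs (1 : fps R) n.

Lemma coefsX_lt f k n : coefs f 0 = 0 -> (n < k)%N -> coefs (f ^+ k) n = 0.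
Proof.
move=> f0; elim: k n => // k IHk n; rewrite ltnS => le_nk.
rewrite exprS coefsM big_ord_recl f0 mul0r add0r big1 // => i _.
rewrite IHk ?mulr0 //= /bump add1n.
by rewrite (leq_trans _ le_nk) // ltn_subrL /= (leq_trans _ (ltn_ord i)).
Qed.

(* For f = c (1 - h) with c invertible and h(0) = 0, the inverse of f is
   c^-1 (1 + h + h^2 + ...), whose n-th coefficient only involves h^j, j <= n. *)
Definition fps_unit : {pred fps R} := fun f => coefs f 0 \is a GRing.unit.
Definition fps_inv f : fps R :=
  if f \in fps_unit then
    let h := 1 - fps_const (coefs f 0)^-1 * f in
    Fps (fun n => (coefs f 0)^-1 * \sum_(j < n.+1) coefs (h ^+ j) n)
  else f.

Fact fps_mulVf : {in fps_unit, left_inverse 1 fps_inv *%R}.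
Proof.
move=> f Uf; rewrite mulrC; apply: fpsP => n; rewrite /fps_inv Uf.
set c := (coefs f 0)^-1; set h := 1 - fps_const c * f.
have h0 : coefs h 0 = 0 by rewrite coefsB coefs_constM mulVr ?subrr.
pose s := \sum_(j < n.+1) h ^+ j.
transitivity (coefs (fps_const c * f * s) n).
  rewrite -mulrA coefs_constM coefsM coefsM mulr_sumr; apply: eq_bigr => i _.
  rewrite mulrCA; congr (_ * (_ * _)); rewrite coefs_sum -!(big_mkord xpredT
    (fun j => coefs (h ^+ j) (n - i))) /=.
  rewrite (@big_cat_nat _ _ _ (n - i).+1 0 n.+1) ?ltnS ?leq_subr //=.
  rewrite [X in _ = _ + X]big_nat [X in _ = _ + X]big1 ?addr0 // => j /andP[lt_ij _].
  exact: coefsX_lt.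
have -> : fps_const c * f = 1 - h by rewrite /h opprB addrCA subrr addr0.
have -> : (1 - h) * s = 1 - h ^+ n.+1.
  by rewrite -[RHS]opprB subrX1 -mulNr [in RHS]opprB.
by rewrite coefsB (coefsX_lt h0) ?subr0 //=.
Qed.

Fact fps_unitPl f g : g * f = 1 -> fps_unit f.
Proof.
move/(congr1 (fun f => coefs f 0)); rewrite coefsM big_ord1 subnn => gf1.
by apply/unitrPr; exists (coefs g 0); rewrite mulrC.
Qed.

Fact fps_inv_out : {in [predC fps_unit], fps_inv =1 id}.
Proof. by move=> f /negbTE /= nUf; rewrite /fps_inv; case: ifP => //; rewrite nUf. Qed.

HB.instance Definition _ := GRing.ComNzRing_hasMulInverse.Build (fps R)
  fps_mulVf fps_unitPl fps_inv_out.

Definition fps_q : fps R := Fps (fun n => (n == 1)%:R).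

(* The infinite product F 1 * F 2 * ..., for F j = 1 + O(q^j): the n-th
   coefficient is that of any partial product with at least n factors (see
   [coefs_infprod]). *)
Definition fps_infprod (F : nat -> fps R) : fps R :=
  Fps (fun n => coefs (\prod_(1 <= j < n.+1) F j) n).

Lemma coefs_qn k n : coefs (fps_q ^+ k) n = (n == k)%:R.
Proof.
elim: k n => [|k IHk] n; first by [].
rewrite exprS coefsM; case: n => [|n].
  by rewrite big_ord1 mul0r.
rewrite 2!big_ord_recl /= mul0r add0r mul1r subn1 /= IHk eqSS.
by rewrite big1 ?addr0 // => i _; rewrite mul0r.
Qed.

Lemma eq1_belowM a f g : eq1_below a f -> eq1_below a g -> eq1_below a (f * g).
Proof.
move=> f1 g1 n lt_na; rewrite -[1 in RHS]mulr1 !coefsM; apply: eq_bigr => i _.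
rewrite f1 ?g1 // ?(leq_ltn_trans (leq_subr _ _)) //.
by apply: leq_ltn_trans lt_na; rewrite -ltnS.
Qed.

Lemma eq1_belowX a f k : eq1_below a f -> eq1_below a (f ^+ k).
Proof.
by move=> f1; elim: k => [|k IHk] //; rewrite exprS; apply: eq1_belowM.
Qed.

Lemma eq1_belowV a f : (0 < a)%N -> eq1_below a f -> eq1_below a f^-1.
Proof.
move=> a_gt0 f1 n lt_na.
have Uf : f \is a GRing.unit by rewrite /in_mem /= /fps_unit f1 ?unitr1.
rewrite -[in RHS](divrr Uf) coefsM big_ord_recl f1 //= mul1r subn0.
rewrite big1 ?addr0 // => i _; rewrite f1 ?mul0r //.
by rewrite (leq_ltn_trans _ lt_na) // (leq_trans _ (ltn_ord i)).
Qed.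

Lemma coefs_qn_lt b a n : (b <= a)%N -> (n < b)%N -> coefs (fps_q ^+ a) n = 0.
Proof.
by move=> le_ba lt_nb; rewrite coefs_qn ltn_eqF // (leq_trans lt_nb).
Qed.

Lemma eq1_belowDq b a : (b <= a)%N -> eq1_below b (1 + fps_q ^+ a).
Proof. by move=> ? n ?; rewrite coefsD (@coefs_qn_lt b) ?addr0. Qed.

Lemma eq1_belowBq b a : (b <= a)%N -> eq1_below b (1 - fps_q ^+ a).
Proof. by move=> ? n ?; rewrite coefsB (@coefs_qn_lt b) ?subr0. Qed.

Lemma coefs_infprod (F : nat -> fps R) n N :
  (forall j, (0 < j)%N -> eq1_below j (F j)) -> (n <= N)%N ->
  coefs (\prod_(1 <= j < N.+1) F j) n = coefs (fps_infprod F) n.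
Proof.
move=> F1 le_nN; rewrite /= (@big_cat_nat _ _ _ n.+1) //=.
have T : eq1_below n.+1 (\prod_(n.+1 <= j < N.+1) F j).
  rewrite big_nat; elim/big_ind: _ => //; first exact: eq1_belowM.
  move=> j /andP[lt_nj _] k lt_kn.
  by apply: F1; [apply: leq_trans lt_nj | apply: leq_trans lt_nj].
rewrite -[in RHS](mulr1 (\prod_(1 <= j < n.+1) F j)) !coefsM.
by apply: eq_bigr => i _; rewrite T // ltnS leq_subr.
Qed.

End Ring.

Arguments fps_q {R}.

Definition schur3_factor (r n : nat) : fps int :=
  let q : fps int := fps_q in
  let k := (2 * n - 1)%N in
  ((1 + q ^+ k) ^+ r * (1 - q ^+ (3 * k)) ^+ r) /
  ((1 + q ^+ (3 * k)) ^+ r * (1 - q ^+ k) ^+ r).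

Definition S3bar (r n : nat) : int := coefs (fps_infprod (schur3_factor r)) n.

Lemma schur3_factor_eq1 r n : (0 < n)%N -> eq1_below n (schur3_factor r n).
Proof.
move=> n_gt0; have le_n : (n <= 2 * n - 1)%N.
  by rewrite mul2n -addnn -addnBA // leq_addr.
have le_n3 : (n <= 3 * (2 * n - 1))%N by apply: leq_trans (leq_pmull _ _).
apply: eq1_belowM; last apply: eq1_belowV => //.
all: by apply: eq1_belowM; apply: eq1_belowX; by [apply: eq1_belowDq | apply: eq1_belowBq].
Qed.

Lemma S3bar_partial r n N : (n <= N)%N ->
  coefs (\prod_(1 <= j < N.+1) schur3_factor r j) n = S3bar r n.
Proof. by apply: coefs_infprod => j; apply: schur3_factor_eq1. Qed.

Definition legendre (a : int) (p : nat) : int :=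
  if (p%:Z %| a)%Z then 0
  else if [exists x : 'I_p, (x%:Z ^+ 2 == a %[mod p%:Z])%Z] then 1 else -1.

(* Main.v *)
Require Import Defs.
From HB Require Import structures.
From mathcomp Require Import all_boot all_order all_algebra.
From mathcomp Require Import zify ring.

Set Implicit Arguments.
Unset Strict Implicit.
Unset Printing Implicit Defensive.

Import Order.TTheory GRing.Theory Num.Theory.
Local Open Scope ring_scope.

(** Modulo 16 only the case [m = 0] matters, because the generating function
    [G] is [1] modulo 2 and so [G ^+ 8] is [1] modulo 16.  For [m = 0] it is a
    quotient of theta functions, [G phi(-q^2) phi(-q^6) = phi(q) phi(-q^3)], by
    Jacobi's triple product.  Dissecting successively by exponents [0] mod 2,
    [2] mod 3, [1] mod 2 and [1] mod 2, each step but the first producing a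
    factor 2, one finds that the coefficient of [q^(2(24k + 11))] is, modulo 16,
    8 times the coefficient of [q^k] in [f_2 psi(q^3)].  When the latter is
    nonzero, [24k + 11 = 2x^2 + 9y^2] for some integers [x] and [y]; this is
    impossible when [24k + 11] has odd valuation at a prime [p] for which [-18]
    is not a square. *)

(** * Dissections of power series *)

(** What shapes the computation is the denominator: extracting a residue class of exponents modulo k
    only passes through factors that are series in q^k ([fps_sec_substM]), so each step needs the
    denominator in that form beforehand. At the start it is even. The identity phi(q) phi(-q) =
    phi(-q^2)^2 then moves the denominator of the even part back to even powers; a difference of
    cubes makes it a series in q^3 for the step modulo 3; before the last step the remaining factor
    [disc3] is absorbed by congruences, phi being 1 modulo 2 and hence its square 1 modulo 4. The
    third step leaves a secondary term with coefficient 4. Modulo 2 it is a series in q^2, so the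
    fourth step kills it. What then remains is a multiple of a square, and squaring is q -> q^2
    modulo 2: this yields one more halving, with no residue to choose, and takes the progression
    2(3(2(2j + 1) + 1) + 2) at j = 2k to 2(24k + 11). *)

Section Dissection.
Variable R : comUnitRingType.
Implicit Types f g h : fps R.

(* At [k = 0] this is the map sending [f] to its constant term. *)
Definition fps_subst k f : fps R :=
  Fps (fun n => if (k %| n)%N then coefs f (n %/ k) else 0).

Definition fps_sec k r f : fps R := Fps (fun n => coefs f (k * n + r)).

Definition fps_neg f : fps R := Fps (fun n => (-1) ^+ n * coefs f n).

Lemma coefs_substM k f n : (0 < k)%N -> coefs (fps_subst k f) (k * n) = coefs f n.
Proof. by move=> k0; rewrite /= dvdn_mulr // mulKn. Qed.

Lemma coefs_subst_ndvd k f n : ~~ (k %| n)%N -> coefs (fps_subst k f) n = 0.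
Proof. by move=> /negbTE /= ->. Qed.

Lemma sum_multiples k n r (F : nat -> R) : (r < k)%N ->
  \sum_(i < (k * n + r).+1) (if (k %| i)%N then F (i %/ k)%N else 0)
    = \sum_(j < n.+1) F j.
Proof.
move=> lt_rk; have k0 : (0 < k)%N by apply: leq_ltn_trans lt_rk.
transitivity (\sum_(i < (k * n + r).+1) \sum_(j < n.+1)
    if (i == k * j :> nat)%N then F j else 0).
  apply: eq_bigr => i _; case: ifPn => [/dvdnP[j Dj] | ndvd].
    have lt_jn : (j < n.+1)%N by have := ltn_ord i; rewrite Dj; nia.
    rewrite (bigD1 (Ordinal lt_jn)) //= Dj mulnC eqxx mulKn // big1 ?addr0 //.
    move=> l ne_lj; rewrite eqn_pmul2l // ifN // eq_sym.
    by apply: contra ne_lj => /eqP Dl; apply/eqP/val_inj.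
  by rewrite big1 // => j _; rewrite ifN //; apply: contraNneq ndvd => ->; apply: dvdn_mulr.
rewrite exchange_big; apply: eq_bigr => j _ /=.
have lt_kj : (k * j < (k * n + r).+1)%N by have := ltn_ord j; nia.
rewrite (bigD1 (Ordinal lt_kj)) //= eqxx big1 ?addr0 // => i ne_i.
by rewrite ifN //; apply: contra ne_i => /eqP Di; apply/eqP/val_inj.
Qed.

(** Only the indices i = kj contribute to the Cauchy product, and the complementary exponent is then
    k(n - j) + r. *)
Lemma fps_sec_substM k r f g :
  (r < k)%N -> fps_sec k r (fps_subst k g * f) = g * fps_sec k r f.
Proof.
move=> lt_rk; have k0 : (0 < k)%N by apply: leq_ltn_trans lt_rk.
apply: fpsP => n; rewrite coefsM /=.
rewrite -(@sum_multiples k n r (fun j => coefs g j * coefs f (k * (n - j) + r))) //.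
apply: eq_bigr => i _; case: ifP => [/dvdnP[j Dj]|]; last by rewrite mul0r.
have := ltn_ord i; rewrite Dj mulnK // => lt_j; congr (_ * coefs f _).
have le_jn : (j <= n)%N by nia.
by rewrite mulnBr [(k * j)%N]mulnC addnBAC // mulnC leq_mul2l le_jn orbT.
Qed.

Lemma fps_sec_subst k r f : (r < k)%N -> fps_sec k r (fps_subst k f) = f *+ (r == 0).
Proof.
move=> lt_rk; apply: fpsP => n; case: eqP => [-> | /eqP r0] /=.
  by rewrite addn0 dvdn_mulr // mulKn // (leq_ltn_trans _ lt_rk).
by rewrite dvdn_addr ?dvdn_mulr // gtnNdvd // lt0n.
Qed.

Lemma fps_secP k f g : (0 < k)%N ->
  (forall r, (r < k)%N -> fps_sec k r f = fps_sec k r g) -> f = g.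
Proof.
move=> k0 fg; apply: fpsP => n; rewrite (divn_eq n k) mulnC.
by have /(congr1 (fun h => coefs h (n %/ k))) := fg _ (ltn_pmod n k0).
Qed.

Fact fps_subst_is_zmod_morphism k : zmod_morphism (fps_subst k).
Proof.
by move=> f g; apply: fpsP => n; rewrite /=; case: ifP; rewrite ?subr0.
Qed.

HB.instance Definition _ k :=
  GRing.isZmodMorphism.Build (fps R) (fps R) (fps_subst k) (fps_subst_is_zmod_morphism k).

Fact fps_subst_is_monoid_morphism k : monoid_morphism (fps_subst k).
Proof.
split=> [|f g].
  apply: fpsP => n /=; case: (posnP k) => [-> | k0].
    by rewrite dvd0n; case: eqP.
  case: ifP => [/dvdnP[m ->] | ]; first by rewrite mulnK // muln_eq0 orbC -[k == 0]negbK -lt0n k0.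
  by case: eqP => // ->; rewrite dvdn0.
case: (posnP k) => [-> | k0].
  apply: fpsP => n; rewrite /= dvd0n; case: eqP => [-> | /eqP n0].
    by rewrite !big_ord1 /=.
  by rewrite big1 // => i _; rewrite !dvd0n subn_eq0; case: eqP => [->|]; rewrite ?mul0r //;
     case: leqP; rewrite ?mulr0 // leqn0 (negbTE n0).
apply: (fps_secP k0) => r lt_rk.
by rewrite fps_sec_substM // !fps_sec_subst // mulrnAr.
Qed.

HB.instance Definition _ k :=
  GRing.isMonoidMorphism.Build (fps R) (fps R) (fps_subst k) (fps_subst_is_monoid_morphism k).

Fact fps_neg_is_zmod_morphism : zmod_morphism fps_neg.
Proof. by move=> f g; apply: fpsP => n; rewrite /= mulrBr. Qed.

HB.instance Definition _ :=
  GRing.isZmodMorphism.Build (fps R) (fps R) fps_neg fps_neg_is_zmod_morphism.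

Fact fps_neg_is_monoid_morphism : monoid_morphism fps_neg.
Proof.
split=> [|f g]; apply: fpsP => n /=.
  by case: n => [|n] /=; rewrite ?mulr1 ?mulr0.
rewrite mulr_sumr; apply: eq_bigr => i _.
by rewrite mulrACA -exprD subnKC // -ltnS.
Qed.

HB.instance Definition _ :=
  GRing.isMonoidMorphism.Build (fps R) (fps R) fps_neg fps_neg_is_monoid_morphism.

Fact fps_sec_is_zmod_morphism k r : zmod_morphism (fps_sec k r).
Proof. by move=> f g; apply: fpsP. Qed.

HB.instance Definition _ k r :=
  GRing.isZmodMorphism.Build (fps R) (fps R) (fps_sec k r) (fps_sec_is_zmod_morphism k r).

Lemma fps_subst_comp k l f : (0 < k)%N -> (0 < l)%N ->
  fps_subst k (fps_subst l f) = fps_subst (k * l) f.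
Proof.
move=> k0 l0; apply: fpsP => n /=; case: ifP => [/dvdnP[m ->] | ndvd].
  by rewrite mulnK // [(m * k)%N]mulnC dvdn_pmul2l // divnMl.
by rewrite ifN //; apply/negP => /(dvdn_trans (dvdn_mulr _ (dvdnn k))); rewrite ndvd.
Qed.

Lemma fps_subst1 f : fps_subst 1 f = f.
Proof. by apply: fpsP => n /=; rewrite dvd1n divn1. Qed.

Lemma fps_subst_q k : (0 < k)%N -> fps_subst k fps_q = fps_q ^+ k :> fps R.
Proof.
move=> k0; apply: fpsP => n; rewrite coefs_qn /=.
case: ifP => [/dvdnP[m ->]|]; first by rewrite mulnK // -{2}[k]mul1n eqn_pmul2r.
by case: eqP => // ->; rewrite dvdnn.
Qed.

Lemma fps_neg_q : fps_neg fps_q = - fps_q :> fps R.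
Proof. by apply: fpsP => -[|[|n]]; rewrite /= ?mulr0 ?mulr1 ?oppr0. Qed.

Lemma fps_neg_subst_even k f : ~~ odd k -> fps_neg (fps_subst k f) = fps_subst k f.
Proof.
move=> even_k; apply: fpsP => n /=; case: ifP => [/dvdnP[m ->]|]; last by rewrite mulr0.
by rewrite -signr_odd oddM (negbTE even_k) andbF mul1r.
Qed.

Lemma fps_neg_subst_odd k f : odd k -> fps_neg (fps_subst k f) = fps_subst k (fps_neg f).
Proof.
move=> odd_k; apply: fpsP => n /=; case: ifP => [/dvdnP[m ->]|]; last by rewrite mulr0.
rewrite mulnK; last by case: k odd_k.
by rewrite -signr_odd oddM odd_k andbT signr_odd.
Qed.

Lemma fps_sec_qM k r j f : (r + j < k)%N ->
  fps_sec k (r + j) (fps_q ^+ j * f) = fps_sec k r f.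
Proof.
move=> lt_k; apply: fpsP => n /=; rewrite addnA.
have lt_j : (j < (k * n + r + j).+1)%N by rewrite ltnS leq_addl.
rewrite (bigD1 (Ordinal lt_j)) //= coefs_qn eqxx mul1r addnK big1 ?addr0 // => i ne_i.
by rewrite coefs_qn -[j]/(val (Ordinal lt_j)) val_eqE (negbTE ne_i) mul0r.
Qed.

Lemma fps_unitE f : (f \is a GRing.unit) = (coefs f 0 \is a GRing.unit).
Proof. by []. Qed.

End Dissection.

(** * Infinite products *)

Section InfProd.
Variable R : comUnitRingType.
Implicit Types F G : nat -> fps R.

Lemma eq_infprod F G :
  (forall j, (0 < j)%N -> F j = G j) -> fps_infprod F = fps_infprod G.
Proof.
move=> FG; apply: fpsP => n /=; congr (coefs _ n).
by apply: eq_big_nat => j /andP[j0 _]; apply: FG.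
Qed.

Lemma infprodM F G : (forall j, (0 < j)%N -> eq1_below j (F j)) ->
  (forall j, (0 < j)%N -> eq1_below j (G j)) ->
  fps_infprod (fun j => F j * G j) = fps_infprod F * fps_infprod G.
Proof.
move=> F1 G1; apply: fpsP => n.
transitivity (coefs (\prod_(1 <= j < n.+1) F j * \prod_(1 <= j < n.+1) G j) n).
  by rewrite -big_split.
rewrite !coefsM; apply: eq_bigr => i _.
by rewrite !coefs_infprod ?leq_subr // -ltnS.
Qed.

Lemma infprodX F r : (forall j, (0 < j)%N -> eq1_below j (F j)) ->
  fps_infprod (fun j => F j ^+ r) = fps_infprod F ^+ r.
Proof.
move=> F1; elim: r => [|r IHr].
  by apply: fpsP => n /=; rewrite big1_eq.
rewrite exprS -IHr -infprodM //; last by move=> j j0; apply/eq1_belowX/F1.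
by apply: eq_infprod => j _; rewrite exprS.
Qed.

Lemma infprod_subst k F : (0 < k)%N -> (forall j, (0 < j)%N -> eq1_below j (F j)) ->
  fps_subst k (fps_infprod F) = fps_infprod (fun j => fps_subst k (F j)).
Proof.
move=> k0 F1; apply: fpsP => n.
transitivity (coefs (fps_subst k (\prod_(1 <= j < n.+1) F j)) n); last by rewrite rmorph_prod.
rewrite /fps_subst /=; case: ifP => // _.
by symmetry; apply: coefs_infprod => //; apply: leq_div.
Qed.

Lemma infprod_neg F :
  fps_neg (fps_infprod F) = fps_infprod (fun j => fps_neg (F j)).
Proof. apply: fpsP => n; transitivity (coefs (fps_neg (\prod_(1 <= j < n.+1) F j)) n) => //.
by rewrite rmorph_prod. Qed.

(** Brings a product over all exponents to the shape of the triple product, whose j-th factor covers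
    a whole period of exponents. *)
Lemma infprod_blocks k F : (0 < k)%N -> (forall j, (0 < j)%N -> eq1_below j (F j)) ->
  fps_infprod F = fps_infprod (fun j => \prod_(i < k) F (k * j.-1 + i.+1)%N).
Proof.
move=> k0 F1; apply: fpsP => n; rewrite [RHS]/=.
have -> : \prod_(1 <= j < n.+1) \prod_(i < k) F (k * j.-1 + i.+1)%N
    = \prod_(1 <= j < (k * n).+1) F j.
  elim: n => [|n IHn]; first by rewrite muln0 !big_geq.
  rewrite big_nat_recr // IHn (@big_cat_nat _ _ _ (k * n).+1 1 (k * n.+1).+1) //=; last by nia.
  congr (_ * _); rewrite -[in RHS](add0n (k * n).+1) big_addn mulnS subSS addnK big_mkord.
  by apply: eq_bigr => i _; rewrite addnS addnC addnS.
by rewrite coefs_infprod // leq_pmull.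
Qed.

End InfProd.

(** * Jacobi's triple product *)

Section FiniteTripleProduct.
Variables (A : comUnitRingType) (x y : A).
Let Q := x * y.

Definition qpoch (q : A) m : A := \prod_(i < m) (1 - q ^+ i.+1).

Hypothesis qpoch_unit : forall m, qpoch Q m \is a GRing.unit.

(* The inverse of [qpoch Q (m - 1)], read as [0] at [m = 0]: this convention
   makes [qbin N n] vanish for [n > N]. *)
Let jp m : A := if m is k.+1 then (qpoch Q k)^-1 else 0.

(** Valid at m = 0 as well, where 1 - Q^0 = 0 agrees with the convention [jp 0 = 0]. *)
Let jpS m : jp m = (1 - Q ^+ m) * jp m.+1.
Proof.
case: m => [|m] /=; first by rewrite expr0 subrr mul0r.
have U := qpoch_unit m.+1; have := U.
rewrite {1 3}/qpoch !big_ord_recr /= -!/(qpoch _ _) unitrM => /andP[Um Uq].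
by rewrite invrM // mulrA divrr // mul1r.
Qed.

(* The Gaussian binomial coefficient [2N, N + n]. *)
Definition qbin N n : A := qpoch Q (2 * N) * jp (N.+1 - n) * jp (N + n).+1.

Lemma qbin_small N n : (N < n)%N -> qbin N n = 0.
Proof. by move=> lt_Nn; rewrite /qbin (eqP lt_Nn) mulr0 mul0r. Qed.

Lemma qbinE N n : (n <= N)%N ->
  qbin N n = qpoch Q (2 * N) / qpoch Q (N - n) / qpoch Q (N + n).
Proof. by move=> le_nN; rewrite /qbin subSn. Qed.

Let qpochSS N :
  qpoch Q (2 * N.+1) = qpoch Q (2 * N) * (1 - Q ^+ (2 * N).+1) * (1 - Q ^+ (2 * N).+2).
Proof. by rewrite mulnS /qpoch !big_ord_recr. Qed.

(** The case n = 0 of the two-step Pascal rule of [qbinSS]: the neighbours -1 and 1 coincide by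
    symmetry, whence the factor 2. *)
Lemma qbinS0 N :
  qbin N.+1 0 = (1 + Q ^+ (2 * N).+1) * qbin N 0 + 2%:R * Q ^+ N.+1 * qbin N 1.
Proof.
rewrite /qbin qpochSS !subn0 subSS subn0 !addn0 addn1.
rewrite (jpS N) !(jpS N.+1) !exprS mulnC !exprM; ring.
Qed.

(** Pascal's rule for Gaussian binomials applied twice, as the upper index goes from 2N to 2N +
    2. *)
Lemma qbinSS N j : (j <= N)%N -> qbin N.+1 j.+1 =
  (1 + Q ^+ (2 * N).+1) * qbin N j.+1 + Q ^+ (N - j) * qbin N j
    + Q ^+ (N + j).+2 * qbin N j.+2.
Proof.
move=> le_jN; have [k ->] : exists k, N = (j + k)%N by exists (N - j)%N; rewrite subnKC.
set N' := (j + k)%N.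
have -> : qbin N'.+1 j.+1 = qpoch Q (2 * N'.+1) * jp k.+1 * jp (N' + j).+3.
  by congr (_ * jp _ * jp _); lia.
have -> : qbin N' j.+1 = qpoch Q (2 * N') * jp k * jp (N' + j).+2.
  by congr (_ * jp _ * jp _); lia.
have -> : qbin N' j = qpoch Q (2 * N') * jp k.+1 * jp (N' + j).+1.
  by congr (_ * jp _ * jp _); lia.
have -> : qbin N' j.+2 = qpoch Q (2 * N') * jp k.-1 * jp (N' + j).+3.
  by congr (_ * jp _ * jp _); lia.
rewrite qpochSS (jpS (N' + j).+1) (jpS (N' + j).+2).
have -> : (2 * N' = (N' + j) + k)%N by lia.
have -> : (N' - j = k)%N by lia.
(* For k = 0, that is j = N, both [jp k] and [jp k.-1] are 0 and only the term in [qbin N j]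
   survives. *)
case: k @N' => [|k] N' /=; last first.
  rewrite -/(jp k.+2) -/(jp k.+1) -/(jp k) (jpS k) (jpS k.+1).
  by rewrite !exprS !exprD exprS; ring.
by rewrite !addn0 !exprS expr0; ring.
Qed.

(* The bilateral terms [x^(n(n+1)/2) y^(n(n-1)/2)] for [n] and [-n]. *)
Definition jterm n : A :=
  x ^+ 'C(n.+1, 2) * y ^+ 'C(n, 2) + x ^+ 'C(n, 2) * y ^+ 'C(n.+1, 2).

Let jterm0 : jterm 0 = 2%:R. Proof. by rewrite /jterm !bin0n /= !expr0 mul1r. Qed.

Let binS2 n : ('C(n.+1, 2) = 'C(n, 2) + n)%N. Proof. by rewrite binS bin1. Qed.

(** With t_n = x^(n(n+1)/2) y^(n(n-1)/2) for integers n, one has x t_n = Q^(-n) t_(n+1) and y t_n =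
    Q^n t_(n-1); the factor Q^N clears the negative powers. *)
Let jtermS N j : (j < N)%N -> Q ^+ N * (x + y) * jterm j.+1
  = Q ^+ (N - j.+1) * jterm j.+2 + Q ^+ (N + j.+1) * jterm j.
Proof.
move=> lt_jN; have [k ->] : exists k, N = (j.+1 + k)%N by exists (N - j.+1)%N; rewrite subnKC.
rewrite addKn /jterm !binS2 /Q !exprMn !exprD !exprS; ring.
Qed.

(** Induction on N: multiplying by the new factor 1 + Q^(2N+1) + Q^N (x + y) acts on the
    coefficients of the bilateral terms exactly as the recurrence of [qbin]. *)
Lemma finite_triple_product N :
  \prod_(i < N) ((1 + Q ^+ i * x) * (1 + Q ^+ i * y)) =
  qbin N 0 + \sum_(j < N) qbin N j.+1 * jterm j.+1.
Proof.
elim: N => [|N IHN].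
  by rewrite !big_ord0 qbinE // /qpoch !big_ord0 !divr1 addr0.
rewrite big_ord_recr /= {}IHN.
pose c := qbin N.
have cN : c N.+1 = 0 by apply: qbin_small.
have cN1 : c N.+2 = 0 by apply: qbin_small.
have step : (\sum_(j < N) c j.+1 * jterm j.+1) * (Q ^+ N * (x + y)) =
   \sum_(j < N) c j.+1 * Q ^+ (N - j.+1) * jterm j.+2
   + \sum_(j < N) c j.+1 * Q ^+ (N + j.+1) * jterm j.
  rewrite mulr_suml -big_split; apply: eq_bigr => j _ /=.
  by rewrite -mulrA [jterm _ * _]mulrC jtermS // mulrDr !mulrA.
have -> : (1 + Q ^+ N * x) * (1 + Q ^+ N * y) = 1 + Q ^+ (2 * N).+1 + Q ^+ N * (x + y).
  by rewrite mul2n -addnn exprS exprD /Q; ring.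
have -> : \sum_(j < N.+1) qbin N.+1 j.+1 * jterm j.+1 =
    (1 + Q ^+ (2 * N).+1) * \sum_(j < N) c j.+1 * jterm j.+1
    + \sum_(j < N.+1) c j * Q ^+ (N - j) * jterm j.+1
    + (\sum_(j < N) c j.+1 * Q ^+ (N + j.+1) * jterm j - c 1 * Q ^+ N.+1 * 2%:R).
  transitivity (\sum_(j < N.+1) ((1 + Q ^+ (2 * N).+1) * (c j.+1 * jterm j.+1)
      + c j * Q ^+ (N - j) * jterm j.+1 + c j.+2 * Q ^+ (N + j.+2) * jterm j.+1)).
    apply: eq_bigr => j _; rewrite qbinSS; last by rewrite -ltnS.
    by rewrite /c !addnS; ring.
  rewrite !big_split /= -mulr_sumr; congr (_ + _ + _).
    by rewrite big_ord_recr /= cN mul0r addr0.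
  (* The shift of index brings in j = 0, where [jterm 0 = 2]; this is the term that [qbinS0]
     consumes. *)
  transitivity (\sum_(j < N.+2) c j.+1 * Q ^+ (N + j.+1) * jterm j - c 1%N * Q ^+ N.+1 * 2%:R).
    by rewrite [in RHS]big_ord_recl /= jterm0 addn1 addrAC subrr add0r.
  by rewrite 2!big_ord_recr /= cN cN1 !mul0r !addr0.
rewrite mulrDr !mulrDl step qbinS0 -/c big_ord_recl /= subn0.
have j1 : jterm 1 = x + y by rewrite /jterm !expr0 !expr1 mulr1 mul1r.
rewrite j1 /bump /=; under [X in _ = _ + (_ + (_ + X) + _)]eq_bigr do rewrite add1n.
ring.
Qed.

End FiniteTripleProduct.

Section TripleProduct.
Variable R : comUnitRingType.
Implicit Types f g : fps R.

Lemma eq1_below_coefsM n g f : eq1_below n.+1 g -> coefs (g * f) n = coefs f n.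
Proof.
move=> g1; rewrite -[in RHS](mul1r f) !coefsM; apply: eq_bigr => i _.
by rewrite g1.
Qed.

Lemma eq1_below_unit n f : eq1_below n.+1 f -> f \is a GRing.unit.
Proof. by move=> f1; rewrite fps_unitE f1 // unitr1. Qed.

Lemma coefs_signM (s : bool) f n : coefs ((-1) ^+ s * f) n = (-1) ^+ s * coefs f n.
Proof. by case: s; rewrite ?expr0 ?expr1 ?mul1r ?mulN1r. Qed.

Variables (s : bool) (a b : nat).
Hypotheses (a_gt0 : (0 < a)%N) (b_gt0 : (0 < b)%N).

Let q : fps R := fps_q.
Let x : fps R := (-1) ^+ s * q ^+ a.
Let y : fps R := (-1) ^+ s * q ^+ b.

Definition jexp n : nat := a * 'C(n.+1, 2) + b * 'C(n, 2).
Definition jexpN n : nat := a * 'C(n, 2) + b * 'C(n.+1, 2).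

(** Ramanujan's theta function, the sum over integers n of x^(n(n+1)/2) y^(n(n-1)/2), at x = q^a, y
    = q^b or at x = -q^a, y = -q^b. The index j stands for n = j + 1 and n = -(j + 1), hence the
    sign in [~~ odd j]. Stopping at j < n loses nothing, because both exponents at j + 1 are at
    least j + 1. *)
Definition jtheta : fps R := Fps (fun n => (n == 0)%:R
  + \sum_(j < n) (-1) ^+ (s && ~~ odd j) * ((n == jexp j.+1)%:R + (n == jexpN j.+1)%:R)).

Let xyE : x * y = q ^+ (a + b).
Proof. by rewrite /x /y mulrACA -signr_addb addbb mul1r -exprD. Qed.

Let geq_bin2 n : (n <= 'C(n.+1, 2))%N.
Proof. by rewrite binS bin1 leq_addl. Qed.

Lemma leq_jexp n : (n <= jexp n)%N.
Proof. by have := geq_bin2 n; rewrite /jexp; nia. Qed.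

Lemma leq_jexpN n : (n <= jexpN n)%N.
Proof. by have := geq_bin2 n; rewrite /jexpN; nia. Qed.

Let jtermE n : jterm x y n = (-1) ^+ (s && odd n) * (q ^+ jexp n + q ^+ jexpN n).
Proof.
have sgn : (-1) ^+ (s * 'C(n.+1, 2)) * (-1) ^+ (s * 'C(n, 2)) = (-1) ^+ (s && odd n) :> fps R.
  rewrite -exprD -mulnDr -signr_odd oddM oddb; congr ((-1) ^+ (_ && _)).
  by rewrite binS bin1 oddD oddD addbC addbA addbb.
rewrite /jterm /x /y !exprMn -!exprM mulrACA [X in _ + X]mulrACA.
rewrite [X in _ + X * _]mulrC sgn -!exprD -mulrDr /jexp /jexpN.
by [].
Qed.

Let coefs_jtermS n j : coefs (jterm x y j.+1) n =
  (-1) ^+ (s && ~~ odd j) * ((n == jexp j.+1)%:R + (n == jexpN j.+1)%:R).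
Proof. by rewrite jtermE coefs_signM coefsD !coefs_qn. Qed.

Let coefs_jterm_lt n j : (n < j)%N -> coefs (jterm x y j) n = 0.
Proof.
move=> lt_nj; rewrite jtermE coefs_signM coefsD !coefs_qn.
by rewrite !ltn_eqF ?addr0 ?mulr0 // (leq_trans lt_nj) ?leq_jexp ?leq_jexpN.
Qed.

Let qpoch_tail n m : (n <= m)%N -> exists2 g, qpoch (x * y) m = qpoch (x * y) n * g & eq1_below n.+1 g.
Proof.
move=> /subnK <-; rewrite addnC; elim: (m - n)%N => [|k [g Dg g1]].
  by exists 1; rewrite ?addn0 ?mulr1.
exists (g * (1 - (x * y) ^+ (n + k).+1)).
  by rewrite addnS {1}/qpoch big_ord_recr /= -/(qpoch _ _) Dg mulrA.
by apply: eq1_belowM => //; rewrite xyE -exprM; apply: eq1_belowBq; nia.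
Qed.

Let qpoch_unit m : qpoch (x * y) m \is a GRing.unit.
Proof.
have [g -> g1] := qpoch_tail (leq0n m).
by rewrite {1}/qpoch big_ord0 mul1r (eq1_below_unit g1).
Qed.

(** The Gaussian binomials tend to the inverse of the infinite product: up to factors 1 +
    O(q^(n+1)), all four finite products equal [qpoch (x * y) n], and these cancel. *)
Let qbin_lim n m N j : (n <= m)%N -> (n + j <= N)%N ->
  eq1_below n.+1 (qpoch (x * y) m * qbin x y N j).
Proof.
move=> le_nm le_N; rewrite qbinE; last by lia.
have [g0 -> g01] := qpoch_tail le_nm.
have [g1 -> g11] : exists2 g, qpoch (x * y) (2 * N) = qpoch (x * y) n * g & eq1_below n.+1 g.
  by apply: qpoch_tail; lia.
have [g2 -> g21] : exists2 g, qpoch (x * y) (N - j) = qpoch (x * y) n * g & eq1_below n.+1 g.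
  by apply: qpoch_tail; lia.
have [g3 -> g31] : exists2 g, qpoch (x * y) (N + j) = qpoch (x * y) n * g & eq1_below n.+1 g.
  by apply: qpoch_tail; lia.
have U := qpoch_unit n; set Z := qpoch _ n in U *.
have U2 := eq1_below_unit g21; have U3 := eq1_below_unit g31.
have -> : Z * g0 * (Z * g1 / (Z * g2) / (Z * g3)) = g0 * g1 * (g2^-1 * g3^-1).
  rewrite !invrM //.
  transitivity (Z / Z * (Z / Z) * (g0 * g1 * (g2^-1 * g3^-1))); last by rewrite divrr // !mul1r.
  ring.
by apply: eq1_belowM; apply: eq1_belowM => //; apply: eq1_belowV.
Qed.

Lemma triple_product :
  fps_infprod (fun j => (1 - q ^+ ((a + b) * j))
     * ((1 + (-1) ^+ s * q ^+ ((a + b) * j.-1 + a))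
        * (1 + (-1) ^+ s * q ^+ ((a + b) * j.-1 + b)))) = jtheta.
Proof.
(* Large enough for [qbin_lim] at every index up to n; bilateral terms of larger index do not reach
   q^n. *)
apply: fpsP => n; pose N := (2 * n).+1.
have prodE : \prod_(1 <= j < N.+1) ((1 - q ^+ ((a + b) * j))
     * ((1 + (-1) ^+ s * q ^+ ((a + b) * j.-1 + a))
        * (1 + (-1) ^+ s * q ^+ ((a + b) * j.-1 + b)))) =
     qpoch (x * y) N * qbin x y N 0
     + \sum_(j < N) qpoch (x * y) N * (qbin x y N j.+1 * jterm x y j.+1).
  rewrite big_split big_add1 big_mkord big_add1 big_mkord /=.
  rewrite -mulr_sumr -mulrDr -(finite_triple_product qpoch_unit); congr (_ * _).
    by apply: eq_bigr => i _; rewrite xyE exprM.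
  apply: eq_bigr => i _; rewrite xyE -exprM /x /y.
  by rewrite !(mulrCA (q ^+ ((a + b) * i))) -!exprD.
rewrite -(@coefs_infprod _ _ n N); last by rewrite /N; lia.
  rewrite prodE coefsD coefs_sum.
  rewrite -[qpoch _ _ * qbin _ _ _ _]mulr1 eq1_below_coefsM; last first.
    by apply: qbin_lim; rewrite /N; lia.
  rewrite [RHS]/=; congr (_ + _).
  pose F j := coefs (qpoch (x * y) N * (qbin x y N j.+1 * jterm x y j.+1)) n.
  have F0 j : (n <= j)%N -> F j = 0.
    move=> le_nj; rewrite /F coefsM big1 // => i _; rewrite coefsM big1 ?mulr0 // => l _.
    rewrite coefs_jterm_lt ?mulr0 //; have := ltn_ord l; lia.
  transitivity (\sum_(j < N) F j) => //.
  rewrite -(big_mkord xpredT F) (@big_cat_nat _ _ _ n) //=; last by rewrite /N; lia.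
  rewrite [X in _ + X]big_nat [X in _ + X]big1 ?addr0 => [|j /andP[/F0]//].
  rewrite big_mkord; apply: eq_bigr => j _.
  rewrite /F mulrA eq1_below_coefsM; last by apply: qbin_lim; have := ltn_ord j; rewrite /N; lia.
  by rewrite coefs_jtermS; do 2!congr (_ * _).
move=> j j0; have sq1 k : (j <= k)%N -> eq1_below j (1 + (-1) ^+ s * q ^+ k).
  by case: s => le_jk; rewrite ?expr1 ?expr0 ?mulN1r ?mul1r; [apply: eq1_belowBq|apply: eq1_belowDq].
apply: eq1_belowM; first by apply: eq1_belowBq; nia.
by apply: eq1_belowM; apply: sq1; nia.
Qed.

End TripleProduct.

(** * Theta functions as products *)

Notation q := (fps_q : fps int).
Notation euler := (fps_infprod (fun j => 1 - q ^+ j)).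
Notation oddp := (fps_infprod (fun j => 1 + q ^+ j.*2.-1)).
Notation oddm := (fps_infprod (fun j => 1 - q ^+ j.*2.-1)).
(* Ramanujan's [phi(q)] and [psi(q)], with exponents [z^2] and [2z^2 + z] for
   integers [z], and [f(q, q^5)], with exponents [3z^2 + 2z]. *)
Notation phi := (jtheta int false 1 1).
Notation psi := (jtheta int false 3 1).
Notation om := (jtheta int false 5 1).

Lemma infprod_unit (F : nat -> fps int) : fps_infprod F \is a GRing.unit.
Proof. by rewrite fps_unitE /= big_geq. Qed.

Lemma oddp_eq1 j : (0 < j)%N -> eq1_below j (1 + q ^+ j.*2.-1).
Proof. by move=> j0; apply: eq1_belowDq; lia. Qed.

Lemma oddm_eq1 j : (0 < j)%N -> eq1_below j (1 - q ^+ j.*2.-1).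
Proof. by move=> j0; apply: eq1_belowBq; lia. Qed.

Lemma euler_eq1 j : (0 < j)%N -> eq1_below j (1 - q ^+ j).
Proof. by move=> j0; apply: eq1_belowBq. Qed.

Lemma fps_subst_qX k n : (0 < k)%N -> fps_subst k (q ^+ n) = q ^+ (k * n).
Proof. by move=> k0; rewrite rmorphXn /= fps_subst_q // exprM. Qed.

Lemma subst_euler k : (0 < k)%N ->
  fps_subst k euler = fps_infprod (fun j => 1 - q ^+ (k * j)).
Proof.
move=> k0; rewrite infprod_subst //; last exact: euler_eq1.
by apply: eq_infprod => j _; rewrite rmorphB rmorph1 /= fps_subst_qX.
Qed.

Lemma subst_oddm k : (0 < k)%N ->
  fps_subst k oddm = fps_infprod (fun j => 1 - q ^+ (k * j.*2.-1)).
Proof.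
move=> k0; rewrite infprod_subst //; last exact: oddm_eq1.
by apply: eq_infprod => j _; rewrite rmorphB rmorph1 /= fps_subst_qX.
Qed.

Lemma subst_oddp k : (0 < k)%N ->
  fps_subst k oddp = fps_infprod (fun j => 1 + q ^+ (k * j.*2.-1)).
Proof.
move=> k0; rewrite infprod_subst //; last exact: oddp_eq1.
by apply: eq_infprod => j _; rewrite rmorphD rmorph1 /= fps_subst_qX.
Qed.

Lemma neg_oddp : fps_neg oddp = oddm.
Proof.
rewrite infprod_neg; apply: eq_infprod => j j0.
rewrite rmorphD rmorph1 rmorphXn /= fps_neg_q exprNn.
have -> : j.*2.-1 = j.-1.*2.+1 by lia.
by rewrite -signr_odd /= odd_double expr1 mulN1r.
Qed.

Ltac eq1 := first [apply: eq1_belowDq; nia | apply: eq1_belowBq; nia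
  | apply: eq1_belowM; eq1 | apply: eq1_belowX; eq1].

Lemma euler_split : euler = fps_subst 2 euler * oddm.
Proof.
rewrite subst_euler // -infprodM; [|by move=> j j0; eq1..].
rewrite (@infprod_blocks _ 2) //; last exact: euler_eq1.
apply: eq_infprod => j j0; rewrite !big_ord_recl big_ord0 mulr1 /= mulrC.
by congr ((1 - _ ^+ _) * (1 - _ ^+ _)); rewrite /bump /=; lia.
Qed.

Lemma oddpm : oddp * oddm = fps_subst 2 oddm.
Proof.
rewrite subst_oddm // -infprodM; [|by move=> j j0; eq1..].
by apply: eq_infprod => j j0; rewrite mulnC exprM; ring.
Qed.

Lemma phi_prod : phi = fps_subst 2 euler * oddp ^+ 2.
Proof.
rewrite -triple_product // subst_euler // expr2 -!infprodM; try by move=> j j0; eq1.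
apply: eq_infprod => j j0; rewrite !expr0 !mul1r addn1.
by have -> : j.*2.-1 = (2 * j.-1 + 1)%N by lia.
Qed.

Lemma psi_prod : psi = fps_subst 4 euler * oddp.
Proof.
rewrite -triple_product // subst_euler // (@infprod_blocks _ 2 (fun j => 1 + q ^+ j.*2.-1)) //;
  last exact: oddp_eq1.
rewrite -!infprodM; try by move=> j j0; rewrite ?big_ord_recl ?big_ord0 ?mulr1; eq1.
apply: eq_infprod => j j0; rewrite !expr0 !mul1r !big_ord_recl big_ord0 mulr1 /= /bump /=.
rewrite [X in _ * X]mulrC.
by congr (_ * ((1 + _ ^+ _) * (1 + _ ^+ _))); lia.
Qed.

(** The triple product supplies the odd exponents congruent to 1 and 5 modulo 6; those congruent to
    3 make up [fps_subst 3 oddp]. *)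
Lemma om_prod : om * fps_subst 3 oddp = fps_subst 6 euler * oddp.
Proof.
rewrite -triple_product // subst_euler // subst_oddp //.
rewrite (@infprod_blocks _ 3 (fun j => 1 + q ^+ j.*2.-1)) //; last exact: oddp_eq1.
rewrite -!infprodM; try by move=> j j0; rewrite ?expr0 ?mul1r ?big_ord_recl ?big_ord0 ?mulr1; eq1.
apply: eq_infprod => j j0; rewrite !expr0 !mul1r !big_ord_recl big_ord0 mulr1 /= /bump /=.
rewrite -mulrA; congr (_ * _).
rewrite [X in X * _]mulrC -mulrA [X in _ * X]mulrC.
by congr ((1 + _ ^+ _) * ((1 + _ ^+ _) * (1 + _ ^+ _))); lia.
Qed.

Lemma euler_pentagonal : euler = jtheta int true 1 2.
Proof.
rewrite -triple_product // (@infprod_blocks _ 3) //; last exact: euler_eq1.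
apply: eq_infprod => j j0; rewrite !expr1 !mulN1r !big_ord_recl big_ord0 mulr1 /= /bump /=.
rewrite mulrA [LHS]mulrC.
by congr ((1 - _ ^+ _) * ((1 - _ ^+ _) * (1 - _ ^+ _))); lia.
Qed.

Lemma neg_phi_prod : fps_neg phi = fps_subst 2 euler * oddm ^+ 2.
Proof. by rewrite phi_prod rmorphM rmorphXn /= fps_neg_subst_even // neg_oddp. Qed.

Lemma neg_om_prod : fps_neg om * fps_subst 3 oddm = fps_subst 6 euler * oddm.
Proof.
have := congr1 (@fps_neg _) om_prod.
by rewrite !rmorphM /= fps_neg_subst_odd // fps_neg_subst_even // neg_oddp.
Qed.

(** The successors encode positivity and let [erefl] produce numeral instances: [subst2_euler 1 3]
    reads f_2 = f_4 (q^2; q^4). *)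
Lemma subst2_euler k l : l.+1 = (k.+1 * 2)%N ->
  fps_subst k.+1 euler = fps_subst l.+1 euler * fps_subst k.+1 oddm.
Proof. by move=> ->; rewrite [in LHS]euler_split rmorphM /= fps_subst_comp. Qed.

Lemma subst_oddpm k l : l.+1 = (k.+1 * 2)%N ->
  fps_subst l.+1 oddm = fps_subst k.+1 oddp * fps_subst k.+1 oddm.
Proof. by move=> ->; rewrite -rmorphM oddpm /= fps_subst_comp. Qed.

Lemma psi_sqr : psi ^+ 2 = phi * fps_subst 2 psi.
Proof.
rewrite phi_prod psi_prod rmorphM /= fps_subst_comp // -[(2 * 4)%N]/8%N.
rewrite (@subst2_euler 1 3 erefl) (@subst_oddpm 0 1 erefl) !fps_subst1.
by rewrite (@subst2_euler 3 7 erefl) (@subst_oddpm 1 3 erefl) (@subst_oddpm 0 1 erefl) !fps_subst1; ring.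
Qed.

Lemma euler_psi : euler * psi = fps_subst 2 euler ^+ 2.
Proof.
rewrite psi_prod {1}euler_split.
transitivity (fps_subst 2 euler * (fps_subst 4 euler * (oddp * oddm))); first by ring.
by rewrite oddpm -(@subst2_euler 1 3 erefl) expr2.
Qed.

Lemma phi_neg_phi : phi * fps_neg phi = fps_subst 2 (fps_neg phi) ^+ 2.
Proof.
rewrite neg_phi_prod phi_prod rmorphM rmorphXn /= fps_subst_comp // -[(2 * 2)%N]/4%N.
by rewrite (@subst2_euler 1 3 erefl) (@subst_oddpm 0 1 erefl) !fps_subst1; ring.
Qed.

(** This is where the Euler function enters the dissection, in [sec_disc3]. The auxiliary unit is
    there because the product for f(-q, -q^5) is available only after multiplication by (q^3;
    q^6). *)
Lemma psi_neg_om : psi * fps_neg om = fps_subst 2 euler * fps_subst 3 psi.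
Proof.
have Um : oddm * fps_subst 3 oddm \is a GRing.unit.
  by rewrite unitrM subst_oddm // !infprod_unit.
apply: (mulIr Um).
transitivity ((psi * oddm) * (fps_neg om * fps_subst 3 oddm)); first by ring.
rewrite neg_om_prod psi_prod rmorphM /= fps_subst_comp // -[(3 * 4)%N]/12%N.
rewrite (@subst2_euler 1 3 erefl) (@subst2_euler 5 11 erefl).
by rewrite (@subst_oddpm 2 5 erefl) (@subst_oddpm 0 1 erefl) !fps_subst1; ring.
Qed.

(** * Theta functions as lattice sums *)

(** Lattice sums are counted in finite windows; any large enough N gives the same count, so that N
    can be chosen freely on each side of a comparison. *)
Definition zbox N : seq int := [seq i%:Z | i <- iota 0 N.+1] ++ [seq - i%:Z | i <- iota 1 N].

Lemma mem_zbox N z : (z \in zbox N) = (`|z| <= N%:Z).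
Proof.
rewrite mem_cat; apply/orP/idP => [[] /mapP[i] | le_zN].
- by rewrite mem_iota => lt_i ->; lia.
- by rewrite mem_iota => lt_i ->; lia.
have [z0 | z0] := lerP 0 z; [left | right]; apply/mapP; exists `|z|%N; rewrite ?mem_iota; lia.
Qed.

Lemma zbox_uniq N : uniq (zbox N).
Proof.
rewrite cat_uniq !map_inj_uniq ?iota_uniq ?andbT /=; try by move=> i j; lia.
apply/hasPn => z /mapP[i]; rewrite mem_iota => lt_i ->.
by rewrite inE negb_or; apply/andP; split; [lia | apply/negP => /mapP[j]]; rewrite mem_iota => lt_j; lia.
Qed.

Lemma count_bij (T U : eqType) (P : pred T) (Q : pred U) (s : seq T) (t : seq U) (f : T -> U) :
  uniq s -> uniq t -> injective f ->
  (forall x, x \in s -> P x -> f x \in t /\ Q (f x)) ->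
  (forall y, y \in t -> Q y -> exists2 x, x \in s & P x /\ y = f x) ->
  count P s = count Q t.
Proof.
move=> us ut injf st ts; rewrite -!size_filter -(size_map f).
apply: perm_size; apply: uniq_perm; rewrite ?map_inj_uniq ?filter_uniq // => y.
rewrite mem_filter; apply/mapP/andP => [[x] | [Qy ty]].
  by rewrite mem_filter => /andP[Px sx] ->; have [] := st _ sx Px.
by have [x sx [Px ->]] := ts _ ty Qy; exists x; rewrite // mem_filter Px.
Qed.

Lemma bin2_double n : (2 * 'C(n.+1, 2) = n.+1 * n)%N.
Proof. by elim: n => // n IHn; rewrite binS bin1 mulnDr IHn; nia. Qed.

(** The equation is twice a z(z+1)/2 + b z(z-1)/2 = n, which avoids division. *)
Lemma coefs_jtheta_count a b N n : (0 < a)%N -> (0 < b)%N -> (n <= N)%N ->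
  coefs (jtheta int false a b) n =
  (count (fun z : int => (a + b)%N%:Z * z ^+ 2 + (a%:Z - b%:Z) * z == (2 * n)%N%:Z) (zbox N))%:R.
Proof.
move=> a0 b0 le_nN; pose P z : bool := (a + b)%N%:Z * z ^+ 2 + (a%:Z - b%:Z) * z == (2 * n)%N%:Z.
have P0 : P 0%N%:Z = (n == 0)%N by rewrite /P; lia.
have Ppos j : P j.+1%:Z = (n == jexp a b j.+1).
  have := bin2_double j; have := bin2_double j.+1; rewrite /P /jexp.
  set u := 'C(_, _); set v := 'C(_, _) => Du Dv; apply/eqP/eqP; nia.
have Pneg j : P (- j.+1%:Z) = (n == jexpN a b j.+1).
  have := bin2_double j; have := bin2_double j.+1; rewrite /P /jexpN.
  set u := 'C(_, _); set v := 'C(_, _) => Du Dv; apply/eqP/eqP; nia.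
rewrite -[X in X%:R]/(count P (zbox N)) count_cat /= !count_map P0 -addnA natrD /=; congr (_ + _).
have count1 (p : pred nat) : count p (iota 1 N) = (\sum_(j < N) p j.+1)%N.
  have -> : iota 1 N = index_iota 1 N.+1 by rewrite /index_iota subSS subn0.
  rewrite -sum1_count big_mkcond big_add1 big_mkord.
  by apply: eq_bigr => i _; case: (p _).
rewrite !count1 -big_split natr_sum /=.
pose F j : int := (n == jexp a b j.+1)%:R + (n == jexpN a b j.+1)%:R.
have F0 j : (n <= j)%N -> F j = 0.
  move=> le_nj; have le1 : (j.+1 <= jexp a b j.+1)%N by apply: leq_jexp.
  have le2 : (j.+1 <= jexpN a b j.+1)%N by apply: leq_jexpN.
  by rewrite /F !ltn_eqF //; lia.
transitivity (\sum_(j < N) F j).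
  rewrite -[RHS](big_mkord xpredT F) (@big_cat_nat _ _ _ n) //=.
  rewrite [X in _ + X]big_nat [X in _ + X]big1 ?addr0 => [|j /andP[/F0]//].
  by rewrite big_mkord; apply: eq_bigr => j _; rewrite expr0 mul1r.
by apply: eq_bigr => j _; rewrite Ppos Pneg natrD.
Qed.

Lemma count_split (T : Type) (a P : pred T) s :
  count P s = (count (predI a P) s + count (predI (predC a) P) s)%N.
Proof. by elim: s => //= x s ->; case: (a x) => /=; lia. Qed.

Lemma count_false (T : eqType) (P : pred T) s : (forall x, ~~ P x) -> count P s = 0.
Proof. by move=> P0; elim: s => //= x s ->; rewrite (negbTE (P0 x)). Qed.

Lemma coefs_qM_S (f : fps int) n : coefs (q * f) n.+1 = coefs f n.
Proof. by have := @fps_sec_qM _ n.+2 n 1 f; rewrite addn1 expr1 => /(_ (leqnn _)) /(congr1 (fun g => coefs g 0)) /=; rewrite !muln0. Qed.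

Lemma coefs_qM_0 (f : fps int) : coefs (q * f) 0 = 0.
Proof. by rewrite coefsM big_ord1 mul0r. Qed.

Lemma coefs_phi N n : (n <= N)%N ->
  coefs phi n = (count (fun z : int => z ^+ 2 == n%:Z) (zbox N))%:R.
Proof.
by move=> le_nN; rewrite (coefs_jtheta_count _ _ le_nN) //; congr _%:R; apply: eq_count => z; lia.
Qed.

(** Squares of multiples of c give phi(q^(c^2)). Any other z is mw + 1 or -(mw + 1), and the two
    signs give the factor 2; the classes of 1 and -1 are disjoint since m > 2. The instances rest on
    (4w + 1)^2 = 8(2w^2 + w) + 1 and (3w + 1)^2 = 3(3w^2 + 2w) + 1. *)
Lemma phi_dissect (c m K : nat) (X : fps int) :
  (0 < c)%N -> (0 < K)%N -> (2 < m)%N ->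
  (forall k N, (k <= N)%N ->
    coefs X k = (count (fun w : int => (m%:Z * w + 1) ^+ 2 == K%:Z * k%:Z + 1) (zbox N))%:R) ->
  (forall w : int, (K%:Z %| (m%:Z * w + 1) ^+ 2 - 1)%Z) ->
  (forall z : int, ~~ (c%:Z %| z)%Z -> exists w, z = m%:Z * w + 1 \/ z = - (m%:Z * w + 1)) ->
  (forall w : int, ~~ (c%:Z %| m%:Z * w + 1)%Z) ->
  phi = fps_subst (c ^ 2) phi + 2%:R * (q * fps_subst K X).
Proof.
move=> c0 K0 m3 HX HK Hc Hm; apply: fpsP => n.
rewrite (coefs_phi (leqnn n)) (count_split (fun z : int => (c%:Z %| z)%Z)) natrD coefsD; congr (_ + _).
  case: (boolP (c ^ 2 %| n)%N) => [/dvdnP[k Dn] | ndvd]; last first.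
    rewrite coefs_subst_ndvd // count_false // => z /=; apply: contra ndvd => /andP[/dvdzP[w ->] /eqP Dn].
    by apply/dvdnP; exists (`|w| ^ 2)%N; nia.
  rewrite [in RHS]Dn [(k * _)%N]mulnC coefs_substM ?expn_gt0 ?c0 // (coefs_phi (leqnn k)); congr _%:R; symmetry.
  apply: (@count_bij _ _ _ _ _ _ (fun w => c%:Z * w)); rewrite ?zbox_uniq //.
  - by move=> w w'; nia.
  - move=> w _ /eqP Dw; rewrite mem_zbox /= dvdz_mulr //; split; first by nia.
    by apply/eqP; rewrite exprMn Dw Dn; nia.
  - move=> z _ /andP[/dvdzP[w Dz] /eqP Dn2]; exists w; last by split; [apply/eqP; nia | nia].
    have Dw : w ^+ 2 = k%:Z by nia.
    by rewrite mem_zbox; nia.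
have -> : coefs (2%:R * (q * fps_subst K X)) n = 2%:R * coefs (q * fps_subst K X) n.
  by rewrite mulr_natl mulr2n coefsD mulr_natl mulr2n.
case: n => [|n].
  rewrite coefs_qM_0 mulr0 count_false // => z; apply/negP => /andP[ndvd /eqP Dz].
  by have z0 : z = 0 by [nia]; case/negP: ndvd; rewrite z0 dvdz0.
rewrite coefs_qM_S; case: (boolP (K %| n)%N) => [/dvdnP[k Dn] | ndvd]; last first.
  rewrite coefs_subst_ndvd // count_false ?mulr0 // => z; apply: contra ndvd => /andP[/= /Hc[w Dz] /eqP Dn].
  have /dvdzP[u Du] := HK w; have Dn2 : n%:Z = u * K%:Z by case: Dz Dn => ->; lia.
  by apply/dvdnP; exists `|u|%N; nia.
rewrite [in RHS]Dn [(k * _)%N]mulnC coefs_substM // (HX k n.+1); last by nia.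
rewrite (count_split (fun z => (m%:Z %| z - 1)%Z)) natrD.
rewrite [RHS]mulr_natl mulr2n; congr (_%:R + _%:R); symmetry.
  apply: (@count_bij _ _ _ _ _ _ (fun w => m%:Z * w + 1)); rewrite ?zbox_uniq //.
  - by move=> w w'; nia.
  - move=> w _ /eqP Dw; rewrite mem_zbox /= addrK dvdz_mulr // Hm; split; first by nia.
    by apply/eqP; rewrite Dw Dn; nia.
  - move=> z; rewrite mem_zbox => le_z /andP[/dvdzP[w Dz] /andP[_ /eqP Dn2]].
    have Dz' : z = m%:Z * w + 1 by lia.
    exists w; first by rewrite mem_zbox; nia.
    by split => //; apply/eqP; rewrite -Dz' Dn2 Dn; nia.
apply: (@count_bij _ _ _ _ _ _ (fun w => - (m%:Z * w + 1))); rewrite ?zbox_uniq //.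
- by move=> w w'; nia.
- move=> w _ /eqP Dw; rewrite mem_zbox /= rpredN Hm; split; first by nia.
  apply/andP; split; last by apply/eqP; rewrite sqrrN Dw Dn; nia.
  apply/negP => /dvdzP[u Du]; have Dt : m%:Z * (u + w) = - 2 by lia.
  by have [] : u + w <= - 1 \/ 0 <= u + w by [lia]; nia.
- move=> z; rewrite mem_zbox => le_z /andP[/negP ndvd /andP[/Hc[w [Dz|Dz]] /eqP Dn2]].
    by case: ndvd; rewrite Dz addrK dvdz_mulr.
  exists w; first by rewrite mem_zbox; nia.
  by split => //; apply/eqP; rewrite -sqrrN -Dz Dn2 Dn; nia.
Qed.

Lemma coefs_psi N n : (n <= N)%N ->
  coefs psi n = (count (fun z : int => 2 * z ^+ 2 + z == n%:Z) (zbox N))%:R.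
Proof.
by move=> le_nN; rewrite (coefs_jtheta_count _ _ le_nN) //; congr _%:R; apply: eq_count => z; lia.
Qed.

Lemma phi_dissect2 : phi = fps_subst 4 phi + 2%:R * (q * fps_subst 8 psi).
Proof.
apply: (@phi_dissect 2 4 8) => // [k N le_kN|w|z|w].
- by rewrite (coefs_psi le_kN); congr _%:R; apply: eq_count => z; lia.
- by apply/dvdzP; exists (2 * w ^+ 2 + w); lia.
- move=> ndvd; have [w Dw] : exists w, z = 4 * w + 1 \/ z = 4 * w + 3.
    by exists (z %/ 4)%Z; move: ndvd; lia.
  by case: Dw => Dz; [exists w; left | exists (- w - 1); right]; lia.
- by lia.
Qed.

Lemma phi_dissect3 : phi = fps_subst 9 phi + 2%:R * (q * fps_subst 3 om).
Proof.
apply: (@phi_dissect 3 3 3) => // [k N le_kN|w|z|w].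
- rewrite (coefs_jtheta_count _ _ le_kN) //; congr _%:R; apply: eq_count => z; lia.
- by apply/dvdzP; exists (3 * w ^+ 2 + 2 * w); lia.
- move=> ndvd; have [w Dw] : exists w, z = 3 * w + 1 \/ z = 3 * w + 2.
    by exists (z %/ 3)%Z; move: ndvd; lia.
  by case: Dw => Dz; [exists w; left | exists (- w - 1); right]; lia.
- by lia.
Qed.

(** Expresses f as the sum of q^(e z) over all integers z: asking for every N >= k forces all
    solutions of e z = k into the window of radius k. *)
Definition theta_for (e : int -> int) (f : fps int) := forall N k, (k <= N)%N ->
  coefs f k = (count (fun z => e z == k%:Z) (zbox N))%:R.

Lemma theta_subst e f K : (0 < K)%N -> theta_for e f ->
  theta_for (fun z => K%:Z * e z) (fps_subst K f).
Proof.
move=> K0 ef N k le_kN; case: (boolP (K %| k)%N) => [/dvdnP[l Dk]|ndvd].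
  rewrite Dk mulnC coefs_substM // (@ef N l); last by nia.
  by congr _%:R; apply: eq_count => z; rewrite PoszM (inj_eq (mulfI _)) //; lia.
rewrite coefs_subst_ndvd // count_false // => z; apply: contra ndvd => /eqP Dk.
by apply/dvdnP; exists `|e z|%N; nia.
Qed.

Lemma count_allpairs (T U : Type) (P : pred (T * U)) s t :
  count P [seq (x, y) | x <- s, y <- t] = (\sum_(x <- s) count (fun y => P (x, y)) t)%N.
Proof. by elim: s => [|x s IHs]; rewrite ?big_nil // big_cons count_cat count_map IHs. Qed.

(** Nonnegativity confines both exponents to the range of the Cauchy product. *)
Lemma theta_mul e e' f g N n : (forall z, 0 <= e z) -> (forall z, 0 <= e' z) ->
  theta_for e f -> theta_for e' g -> (n <= N)%N ->
  coefs (f * g) n = (count (fun p => e p.1 + e' p.2 == n%:Z)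
    [seq (x, y) | x <- zbox N, y <- zbox N])%:R.
Proof.
move=> e0 e'0 ef eg le_nN; rewrite count_allpairs natr_sum coefsM.
transitivity (\sum_(i < n.+1) \sum_(z <- zbox N) (e z == i%:Z)%:R * coefs g (n - i)).
  apply: eq_bigr => i _; rewrite -mulr_suml (ef N); last by have := ltn_ord i; lia.
  by rewrite -sum1_count natr_sum big_mkcond; congr (_ * _); apply: eq_bigr => z _; case: (_ == _).
rewrite exchange_big; apply: eq_bigr => z _.
have [le_en | lt_ne] := leqP `|e z|%N n; last first.
  rewrite big1 => [|i _]; last first.
    by case: eqP => [Dz|]; rewrite ?mul0r //; have := ltn_ord i; lia.
  by rewrite count_false // => w; apply/eqP => /= Dn; have := e'0 w; have := e0 z; lia.
rewrite (bigD1 (Ordinal (le_en : (`|e z| < n.+1)%N))) //= gez0_abs // eqxx mul1r.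
rewrite big1 ?addr0 => [|i ne_i]; last first.
  case: eqP => [Dz|]; rewrite ?mul0r //; case/eqP: ne_i; apply: val_inj => /=; lia.
rewrite (eg N); last by lia.
by congr _%:R; apply: eq_count => w /=; have := e0 z; lia.
Qed.

Lemma coefs_natM c (f : fps int) n : coefs (c%:R * f) n = c%:R * coefs f n.
Proof. by elim: c => [|c IHc]; rewrite ?mul0r // -!natr1 !mulrDl coefsD IHc !mul1r. Qed.

Lemma zbox2_uniq N : uniq [seq (x, y) | x <- zbox N, y <- zbox N].
Proof. by apply: allpairs_uniq; rewrite ?zbox_uniq // => -[x y] [x' y'] _ _. Qed.

Lemma mem_zbox2 N (p : int * int) :
  (p \in [seq (x, y) | x <- zbox N, y <- zbox N]) = (`|p.1| <= N%:Z) && (`|p.2| <= N%:Z).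
Proof.
rewrite -!mem_zbox; apply/allpairsP/andP => [[[x y] [sx sy ->]] // | [sx sy]].
by exists p; case: p sx sy.
Qed.

(* The identity [(a + 3b + 1)^2 + 3(a - b)^2 = 2(2a^2 + a + 3(2b^2 + b)) + 1]
   parametrizes one of each pair of opposite lattice points. *)
Lemma phi_phi3_odd :
  fps_sec 2 1 (phi * fps_subst 3 phi) = 2%:R * (psi * fps_subst 3 psi).
Proof.
have tphi : theta_for (fun z => z ^+ 2) phi by move=> N k; apply: coefs_phi.
have tpsi : theta_for (fun z => 2 * z ^+ 2 + z) psi by move=> N k; apply: coefs_psi.
have sq0 (z : int) : 0 <= z ^+ 2 by apply: sqr_ge0.
have sq3 (z : int) : 0 <= 3%:Z * z ^+ 2 by rewrite mulr_ge0.
have abs_sq (z : int) : `|z| <= z ^+ 2 by nia.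
have tr0 (z : int) : 0 <= 2 * z ^+ 2 + z by nia.
have abs_tr (z : int) : `|z| <= 2 * z ^+ 2 + z by nia.
have tr3 (z : int) : 0 <= 3%:Z * (2 * z ^+ 2 + z) by rewrite mulr_ge0.
apply: fpsP => n; rewrite coefs_natM.
transitivity (coefs (phi * fps_subst 3 phi) (2 * n + 1)) => //.
rewrite (theta_mul sq0 sq3 tphi (theta_subst _ tphi) (leqnn _)) //.
have le_n : (n <= 2 * n + 1)%N by lia.
rewrite (theta_mul tr0 tr3 tpsi (theta_subst _ tpsi) le_n) //.
(* As x^2 + 3y^2 is odd, x - y is 1 or 3 modulo 4, and negating (x, y) exchanges the two cases. *)
rewrite (count_split (fun p : int * int => (4 %| p.1 - p.2 - 1)%Z)) natrD.
rewrite [RHS]mulr_natl mulr2n; congr (_%:R + _%:R); symmetry.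
  apply: (@count_bij _ _ _ _ _ _ (fun p => (p.1 + 3 * p.2 + 1, p.1 - p.2)));
    rewrite ?zbox2_uniq //.
  - by move=> [a b] [a' b'] /= [E1 E2]; congr (_, _); lia.
  - move=> [a b] _ /= /eqP Dn; rewrite mem_zbox2 /=; split; last first.
      by apply/andP; split; [lia | apply/eqP; lia].
    have := abs_sq (a + 3 * b + 1); have := abs_sq (a - b); lia.
  - move=> [x y] _ /= /andP[/dvdzP[b Db] /eqP Dn]; have Dx : x = y + 4 * b + 1 by lia.
    move: Dn; rewrite {}Dx => Dn {x Db}; exists (y + b, b) => /=; last first.
      by split; [apply/eqP; lia | congr (_, _); lia].
    by rewrite mem_zbox2 /=; have := abs_tr (y + b); have := abs_tr b; lia.
apply: (@count_bij _ _ _ _ _ _ (fun p => (- (p.1 + 3 * p.2 + 1), p.2 - p.1)));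
  rewrite ?zbox2_uniq //.
- by move=> [a b] [a' b'] /= [E1 E2]; congr (_, _); lia.
- move=> [a b] _ /= /eqP Dn; rewrite mem_zbox2 /=; split; last first.
    by apply/andP; split; [lia | apply/eqP; lia].
  have := abs_sq (a + 3 * b + 1); have := abs_sq (a - b); lia.
- move=> [x y] _ /= /andP[ndvd /eqP Dn].
  have {ndvd} [b Db] : exists b, y - x = 4 * b + 1.
    exists ((y - x) %/ 4)%Z; have odd_xy : ((y - x) %% 2)%Z = 1.
      by apply/eqP; have := @modz_ge0 (y - x) 2 isT; nia.
    by move: ndvd; lia.
  have Dx : x = y - 4 * b - 1 by lia.
  move: Dn; rewrite {}Dx => Dn {x Db}; exists (b - y, b) => /=; last first.
    by split; [apply/eqP; lia | congr (_, _); lia].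
  by rewrite mem_zbox2 /=; have := abs_tr (b - y); have := abs_tr b; lia.
Qed.

(** * Dissecting the generating function *)

Notation nphi := (fps_neg phi).
Notation W := (fps_neg om).
Notation G := (fps_infprod (schur3_factor 1)).

Lemma schur3_factorX r j : schur3_factor r j = schur3_factor 1 j ^+ r.
Proof. by rewrite /schur3_factor !expr1 exprMn exprVn !exprMn. Qed.

Lemma S3bar_pow r n : S3bar r n = coefs (G ^+ r) n.
Proof.
rewrite -infprodX; last by move=> j; apply: schur3_factor_eq1.
by rewrite /S3bar (@eq_infprod _ _ (fun j => schur3_factor 1 j ^+ r)) // => j _; apply: schur3_factorX.
Qed.

Lemma schur3_prod : G * (fps_subst 3 oddp * oddm) = oddp * fps_subst 3 oddm.
Proof.
rewrite subst_oddp // subst_oddm // -!infprodM;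
  try by [move=> j j0; eq1 | move=> j; apply: schur3_factor_eq1].
apply: eq_infprod => j j0; rewrite /schur3_factor !expr1.
have -> : (2 * j - 1)%N = j.*2.-1 by lia.
rewrite divrK // unitrM !fps_unitE !coefsB !coefsD !coefs1 !coefs_qn.
have -> : (0 == 3 * j.*2.-1)%N = false by lia.
by have -> : (0 == j.*2.-1)%N = false by lia.
Qed.

Lemma schur3_theta : G * fps_subst 2 nphi * fps_subst 6 nphi = phi * fps_subst 3 nphi.
Proof.
rewrite neg_phi_prod phi_prod !expr2 !rmorphM /= !fps_subst_comp //.
rewrite -[(2 * 2)%N]/4%N -[(6 * 2)%N]/12%N -[(3 * 2)%N]/6%N.
transitivity (G * (fps_subst 2 euler * fps_subst 2 oddm) * (fps_subst 6 euler * fps_subst 6 oddm)).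
  by rewrite (@subst2_euler 1 3 erefl) (@subst2_euler 5 11 erefl); ring.
rewrite (@subst_oddpm 0 1 erefl) (@subst_oddpm 2 5 erefl) !fps_subst1.
transitivity (G * (fps_subst 3 oddp * oddm) * (fps_subst 2 euler * oddp * fps_subst 6 euler * fps_subst 3 oddm)); first by ring.
by rewrite schur3_prod; ring.
Qed.

Lemma fps_sec_qX k r j (f : fps int) : (r < k)%N -> (j < k)%N ->
  fps_sec k r (q ^+ j * fps_subst k f) = f *+ (r == j).
Proof.
move=> lt_rk lt_jk; rewrite mulrC fps_sec_substM // -mulr_natr; congr (_ * _).
apply: fpsP => n; transitivity ((k * n + r == j)%N%:R : int); first exact: coefs_qn.
have -> : (k * n + r == j)%N = (r == j) && (n == 0)%N by case: n => [|n]; nia.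
by case: (r == j).
Qed.

Lemma fps_sec2E (f : fps int) :
  f = fps_subst 2 (fps_sec 2 0 f) + q * fps_subst 2 (fps_sec 2 1 f).
Proof.
apply: (@fps_secP _ 2) => // r lt_r2.
rewrite raddfD /= fps_sec_subst // -[q]expr1 fps_sec_qX //.
by case: r lt_r2 => [|[|]] //= _; rewrite ?addr0 ?add0r.
Qed.

Lemma fps_sec2_0 (f g : fps int) : fps_sec 2 0 (fps_subst 2 f + q * fps_subst 2 g) = f.
Proof. by rewrite raddfD /= fps_sec_subst // -[q]expr1 fps_sec_qX // addr0. Qed.

Lemma fps_sec3_2 (f g h : fps int) :
  fps_sec 3 2 (fps_subst 3 f + q * fps_subst 3 g + q ^+ 2 * fps_subst 3 h) = h.
Proof. by rewrite !raddfD /= fps_sec_subst // -[q]expr1 !fps_sec_qX // !add0r. Qed.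

Lemma nphi_dissect2 : nphi = fps_subst 4 phi - 2%:R * (q * fps_subst 8 psi).
Proof.
rewrite {1}phi_dissect2 rmorphD !rmorphM rmorph_nat /= fps_neg_q.
by rewrite !fps_neg_subst_even //; ring.
Qed.

Lemma nphi_dissect3 : nphi = fps_subst 9 nphi - 2%:R * (q * fps_subst 3 W).
Proof.
rewrite {1}phi_dissect3 rmorphD !rmorphM rmorph_nat /= fps_neg_q.
by rewrite !fps_neg_subst_odd //; ring.
Qed.

(** The 2-dissections of the factors give phi(q^2) phi(q^6) - 4q^2 psi(q^4) psi(q^12). By
    [phi_phi3_odd] taken at q^2, the subtracted term is twice the odd part of phi(q) phi(q^3) at
    q^2; removing an odd part twice changes the sign of the variable. *)
Lemma subst_phi_neg3_even :
  fps_sec 2 0 (phi * fps_subst 3 nphi) = fps_subst 2 nphi * fps_subst 6 nphi.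
Proof.
pose T := psi * fps_subst 3 psi; pose p := fps_sec 2 0 (phi * fps_subst 3 phi).
have phi3E : phi * fps_subst 3 phi = fps_subst 2 p + 2%:R * (q * fps_subst 2 T).
  by rewrite {1}[LHS]fps_sec2E phi_phi3_odd rmorphM rmorph_nat /= -/p -/T; ring.
have nphi3E : nphi * fps_subst 3 nphi = fps_subst 2 p - 2%:R * (q * fps_subst 2 T).
  rewrite -fps_neg_subst_odd // -rmorphM phi3E rmorphD !rmorphM rmorph_nat /=.
  by rewrite fps_neg_q !fps_neg_subst_even //; ring.
have subst6 f : fps_subst 6 f = fps_subst 2 (fps_subst 3 f) :> fps int by rewrite fps_subst_comp.
have subst4 f : fps_subst 4 f = fps_subst 2 (fps_subst 2 f) :> fps int by rewrite fps_subst_comp.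
have phi2E := congr1 (@fps_subst _ 2) phi3E.
rewrite rmorphM rmorphD !rmorphM rmorph_nat /= fps_subst_q // -subst6 in phi2E.
rewrite subst6 -rmorphM nphi3E rmorphB !rmorphM rmorph_nat /= fps_subst_q //.
have -> : phi * fps_subst 3 nphi =
    fps_subst 2 (fps_subst 2 phi * fps_subst 6 phi
                 - 4%:R * q ^+ 2 * fps_subst 4 psi * fps_subst 12 psi)
    + q * fps_subst 2 (2%:R * fps_subst 4 psi * fps_subst 6 phi
                       - 2%:R * q * fps_subst 2 phi * fps_subst 12 psi).
  rewrite {1}phi_dissect2 nphi_dissect2.
  rewrite !(rmorph_nat, rmorphXn, rmorphB, rmorphM) /= !fps_subst_comp // !fps_subst_q //.
  rewrite -[(3 * 4)%N]/12%N -[(3 * 8)%N]/24%N -[(2 * 2)%N]/4%N -[(2 * 6)%N]/12%N.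
  rewrite -[(2 * 4)%N]/8%N -[(2 * 12)%N]/24%N; ring.
rewrite fps_sec2_0 phi2E  !fps_subst_comp //.
rewrite -[(2 * 2)%N]/4%N -[(4 * 3)%N]/12%N; ring.
Qed.

(** * Congruences *)

Definition eqm c (f g : fps int) := exists h, f = g + c%:R * h.

Lemma eqm_refl c f : eqm c f f.
Proof. by exists 0; rewrite mulr0 addr0. Qed.

Lemma eqm_sym c f g : eqm c f g -> eqm c g f.
Proof. by move=> [h ->]; exists (- h); ring. Qed.

Lemma eqm_trans c g f h : eqm c f g -> eqm c g h -> eqm c f h.
Proof. by move=> [u ->] [v ->]; exists (u + v); ring. Qed.

Lemma eqmD c f g f' g' : eqm c f g -> eqm c f' g' -> eqm c (f + f') (g + g').
Proof. by move=> [u ->] [v ->]; exists (u + v); ring. Qed.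

Lemma eqmM c f g f' g' : eqm c f g -> eqm c f' g' -> eqm c (f * f') (g * g').
Proof. by move=> [u ->] [v ->]; exists (u * g' + v * g + c%:R * u * v); ring. Qed.

Lemma eqm_scale d c f g : eqm c f g -> eqm (d * c) (d%:R * f) (d%:R * g).
Proof. by move=> [u ->]; exists u; rewrite natrM; ring. Qed.

Lemma eqm_subst k c f g : eqm c f g -> eqm c (fps_subst k f) (fps_subst k g).
Proof. by move=> [u ->]; exists (fps_subst k u); rewrite rmorphD rmorphM rmorph_nat. Qed.

Lemma eqm_neg c f g : eqm c f g -> eqm c (fps_neg f) (fps_neg g).
Proof. by move=> [u ->]; exists (fps_neg u); rewrite rmorphD rmorphM rmorph_nat. Qed.

Lemma fps_sec_natM k r c (f : fps int) : fps_sec k r (c%:R * f) = c%:R * fps_sec k r f.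
Proof. by rewrite !mulr_natl raddfMn. Qed.

Lemma eqm_sec k r c f g : eqm c f g -> eqm c (fps_sec k r f) (fps_sec k r g).
Proof. by move=> [u ->]; exists (fps_sec k r u); rewrite raddfD /= fps_sec_natM. Qed.

Lemma eqm_coefs c f g n : eqm c f g -> (coefs f n = coefs g n %[mod c%:Z])%Z.
Proof. by move=> [u ->]; rewrite coefsD coefs_natM natz addrC [_ * coefs _ _]mulrC modzMDl. Qed.

Lemma eqm_cancel c u f g : u \is a GRing.unit -> eqm c (f * u) (g * u) -> eqm c f g.
Proof.
move=> Uu [h fg]; exists (h / u); apply: (mulIr Uu).
by rewrite fg mulrDl mulrA divrK.
Qed.

Lemma eqm2_sq f g : eqm 2 f g -> eqm 4 (f ^+ 2) (g ^+ 2).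
Proof. by move=> [u ->]; exists (u * g + u ^+ 2); ring. Qed.

Lemma sum_nat_tail (F : nat -> int) n a : (a <= n.+1)%N ->
  \sum_(n.+1 - a <= i < n.+1) F i = \sum_(0 <= i < a) F (n - i)%N.
Proof.
elim: a => [|a IHa] le_an; first by rewrite subn0 !big_geq.
rewrite [in RHS]big_nat_recr //= -IHa; last by lia.
rewrite big_ltn; last by lia.
by rewrite addrC subSS; congr (_ + _); congr (\sum_(_ <= i < _) _); lia.
Qed.

Lemma sum_nat_sym (F : nat -> int) n : (forall i, (i <= n)%N -> F (n - i)%N = F i) ->
  \sum_(0 <= i < n.+1) F i =
  2%:R * (\sum_(0 <= i < uphalf n) F i) + (if odd n then 0 else F n./2).
Proof.
move=> Fsym; pose a := uphalf n.
have le_a : (a <= n.+1 - a)%N by rewrite /a; lia.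
have tailE : \sum_(n.+1 - a <= i < n.+1) F i = \sum_(0 <= i < a) F i.
  rewrite sum_nat_tail; last by rewrite /a; lia.
  by apply: eq_big_nat => i /andP[_ lt_ia]; apply: Fsym; rewrite /a in lt_ia; lia.
rewrite (@big_cat_nat _ _ _ (n.+1 - a)) //=; last by rewrite leq_subr.
rewrite tailE (@big_cat_nat _ _ _ a 0 (n.+1 - a)) //=.
rewrite mulr_natl mulr2n -addrA -[RHS]addrA; congr (_ + _).
rewrite addrC; congr (_ + _); case: ifP => odd_n.
  by rewrite big_geq //; rewrite /a; lia.
have -> : (n.+1 - a = a.+1)%N by rewrite /a; lia.
by rewrite big_nat1; congr F; rewrite /a; lia.
Qed.

(** The terms i and n - i of the Cauchy square pair off, and the middle one is x^2, congruent to x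
    modulo 2. *)
Lemma eqm2_frobenius f : eqm 2 (f ^+ 2) (fps_subst 2 f).
Proof.
pose h n := coefs (f ^+ 2) n - coefs (fps_subst 2 f) n.
suff even_h n : (2 %| h n)%Z.
  exists (Fps (fun n => (h n %/ 2)%Z)); apply: fpsP => n; rewrite coefsD coefs_natM.
  by rewrite [coefs (Fps _) n]/= mulrC divzK // /h addrC subrK.
pose F i := coefs f i * coefs f (n - i).
have sumE : coefs (f ^+ 2) n = \sum_(0 <= i < n.+1) F i by rewrite expr2 coefsM big_mkord.
rewrite /h sumE sum_nat_sym => [|i le_in]; last by rewrite /F subKn // mulrC.
rewrite -addrA rpredD ?dvdz_mulr //; case: ifP => odd_n.
  by rewrite coefs_subst_ndvd ?subrr // dvdn2 negbK odd_n.
have Dn : n = (2 * n./2)%N by lia.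
have -> : coefs (fps_subst 2 f) n = coefs f n./2 by rewrite {1}Dn coefs_substM.
rewrite /F; have -> : (n - n./2 = n./2)%N by lia.
set x := coefs f _; have [y Dy] : exists y, x = 2 * y \/ x = 2 * y + 1.
  by exists (x %/ 2)%Z; lia.
by apply/dvdzP; case: Dy => ->; [exists (2 * y ^+ 2 - y) | exists (2 * y ^+ 2 + y)]; ring.
Qed.

Lemma phi_eqm2 : eqm 2 phi 1.
Proof.
exists (Fps (fun n => \sum_(j < n) (n == jexp 1 1 j.+1)%:R)); apply: fpsP => n.
rewrite coefsD coefs_natM coefs1 /=; congr (_ + _); rewrite mulr_sumr.
apply: eq_bigr => j _; rewrite expr0 mul1r.
have -> : jexpN 1 1 j.+1 = jexp 1 1 j.+1 by rewrite /jexp /jexpN addnC.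
by rewrite mulr_natl mulr2n.
Qed.

Lemma nphi_eqm2 : eqm 2 nphi 1.
Proof. by have := eqm_neg phi_eqm2; rewrite rmorph1. Qed.

Lemma subst_nphi_eqm2 k : eqm 2 (fps_subst k nphi) 1.
Proof. by have := eqm_subst k nphi_eqm2; rewrite rmorph1. Qed.

Lemma S3bar_mod16 m n : (S3bar (8 * m + 1) n = coefs G n %[mod 16])%Z.
Proof.
have [h Gh] : eqm 2 G 1.
  have [u Du] := subst_nphi_eqm2 2; have [v Dv] := subst_nphi_eqm2 6.
  have [w Dw] := phi_eqm2; have [t Dt] := subst_nphi_eqm2 3.
  have := schur3_theta; rewrite Du Dv Dt Dw => GE.
  (* Solves G (1 + 2u)(1 + 2v) = (1 + 2w)(1 + 2t) for G - 1. *)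
  exists (w + t + 2%:R * w * t - G * (u + v + 2%:R * u * v)).
  apply: (addIr (G * (2%:R * (u + v + 2%:R * u * v)))).
  transitivity (G * (1 + 2%:R * u) * (1 + 2%:R * v)); first by ring.
  by rewrite GE; ring.
have G8 : eqm 16 (G ^+ 8) 1.
  (* The coefficients are binom(8, i) 2^i / 16, from the expansion of (1 + 2h)^8. *)
  exists (h + 7%:R * h ^+ 2 + 28%:R * h ^+ 3 + 70%:R * h ^+ 4 + 112%:R * h ^+ 5
    + 112%:R * h ^+ 6 + 64%:R * h ^+ 7 + 16%:R * h ^+ 8).
  by rewrite Gh; ring.
rewrite S3bar_pow; apply: (@eqm_coefs 16); rewrite exprD exprM expr1 -[X in eqm _ _ X]mul1r.
apply: eqmM (eqm_refl _ _); elim: m => [|m IHm]; first exact: eqm_refl.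
by rewrite exprS -[1]mulr1; apply: eqmM.
Qed.

Lemma phi_unit : phi \is a GRing.unit.
Proof. by rewrite fps_unitE /= big_ord0. Qed.

Lemma nphi_unit : nphi \is a GRing.unit.
Proof. by rewrite fps_unitE /= big_ord0. Qed.

Notation E := (fps_sec 2 0 G).

(** Extraction alone gives the denominator phi(-q) phi(-q^3). Multiplying by phi(q) phi(q^3) and
    using [phi_neg_phi] at q and q^3 makes it even, as the later steps modulo 2 require. *)
Lemma schur3_even : E * (fps_subst 2 nphi * fps_subst 6 nphi) = phi * fps_subst 3 phi.
Proof.
have base : E * (nphi * fps_subst 3 nphi) = fps_subst 2 nphi * fps_subst 6 nphi.
  rewrite -subst_phi_neg3_even -schur3_theta.
  have -> : G * fps_subst 2 nphi * fps_subst 6 nphi = fps_subst 2 (nphi * fps_subst 3 nphi) * G.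
    by rewrite rmorphM /= fps_subst_comp // -[(2 * 3)%N]/6%N; ring.
  by rewrite fps_sec_substM // mulrC.
have sq3 : fps_subst 3 phi * fps_subst 3 nphi = fps_subst 6 nphi ^+ 2.
  by rewrite -rmorphM phi_neg_phi rmorphXn /= fps_subst_comp.
have Un : fps_subst 2 nphi * fps_subst 6 nphi \is a GRing.unit.
  by rewrite unitrM !rmorph_unit ?phi_unit.
apply: (mulIr Un).
transitivity (E * fps_subst 2 nphi ^+ 2 * fps_subst 6 nphi ^+ 2); first by ring.
rewrite -phi_neg_phi -sq3.
transitivity (E * (nphi * fps_subst 3 nphi) * phi * fps_subst 3 phi); first by ring.
by rewrite base; ring.
Qed.

(* The factor brought out by rationalizing [phi(-q^2) = A - 2q^2 B] (see
   [nphi_dissect3]) into [A^3 - 8q^6 B^3], a series in [q^3]. *)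
Definition disc3 : fps int := (fps_subst 3 nphi ^+ 3 - 8%:R * (q * W ^+ 3)) * nphi.

(** With A, B as above, this comes from phi(q^3) (phi(q^9) + 2q om(q^3)) (A^2 + 2q^2 AB + 4q^4 B^2):
    the exponents 2 modulo 3 arise from 2q^2 phi(q^9) AB and 8q^5 om(q^3) B^2 only. The factor 2q^2
    is taken out and q^3 is replaced by q. *)
Definition disc3_num : fps int :=
  phi * (fps_subst 3 phi * fps_subst 6 nphi * fps_subst 2 W
         + 4%:R * (q * om * fps_subst 2 W ^+ 2)).

Lemma disc3_unit : disc3 \is a GRing.unit.
Proof.
rewrite /disc3 unitrM nphi_unit andbT fps_unitE coefsB coefs_natM coefs_qM_0 mulr0 subr0.
by rewrite -fps_unitE unitrX // rmorph_unit ?nphi_unit.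
Qed.

Lemma schur3_even_sec3 :
  fps_sec 3 2 E * fps_subst 2 disc3 = 2%:R * disc3_num.
Proof.
pose A := fps_subst 18 nphi; pose B := fps_subst 6 W.
have nphi2 : fps_subst 2 nphi = A - 2%:R * q ^+ 2 * B.
  rewrite {1}nphi_dissect3 rmorphB !rmorphM rmorph_nat /= !fps_subst_comp // fps_subst_q //.
  by rewrite /A /B -[(2 * 9)%N]/18%N -[(2 * 3)%N]/6%N; ring.
(* Multiplication of A - 2q^2 B by A^2 + 2q^2 AB + 4q^4 B^2 gives A^3 - 8q^6 B^3; together with
   phi(-q^6) this is [disc3] at q^6. *)
have key : fps_subst 3 (fps_subst 2 disc3) * E =
   fps_subst 3 phi * (fps_subst 9 phi + 2%:R * (q * fps_subst 3 om))
     * (A ^+ 2 + 2%:R * q ^+ 2 * A * B + 4%:R * q ^+ 4 * B ^+ 2).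
  transitivity (E * (fps_subst 2 nphi * fps_subst 6 nphi)
     * (A ^+ 2 + 2%:R * q ^+ 2 * A * B + 4%:R * q ^+ 4 * B ^+ 2)); last first.
    by rewrite schur3_even {1}phi_dissect3; ring.
  rewrite nphi2 /disc3 fps_subst_comp // -[(3 * 2)%N]/6%N.
  rewrite !(rmorph_nat, rmorphXn, rmorphB, rmorphM) /= !fps_subst_comp // fps_subst_q //.
  by rewrite -[(6 * 3)%N]/18%N -/A -/B; ring.
rewrite mulrC -fps_sec_substM // key.
(* [a] and [b] are the parts with exponents 0 and 1 modulo 3, spelled out so that [ring] can confirm
   the 3-dissection. *)
pose a := phi * (fps_subst 3 phi * fps_subst 6 nphi ^+ 2 + 4%:R * q * om * fps_subst 6 nphi * fps_subst 2 W).
pose b := phi * (4%:R * q * fps_subst 3 phi * fps_subst 2 W ^+ 2 + 2%:R * om * fps_subst 6 nphi ^+ 2).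
rewrite -[RHS](@fps_sec3_2 a b); congr fps_sec.
rewrite /a /b /disc3_num.
rewrite !(rmorph_nat, rmorphXn, rmorphD, rmorphM) /= !fps_subst_comp // fps_subst_q //.
by rewrite -[(3 * 6)%N]/18%N -[(3 * 3)%N]/9%N -[(3 * 2)%N]/6%N -/A -/B; ring.
Qed.

Lemma schur3_coef j : coefs G (2 * (3 * (2 * j + 1) + 2)) =
  2%:R * coefs (fps_sec 2 1 (disc3_num / fps_subst 2 disc3)) j.
Proof.
have sec3E : fps_sec 3 2 E = 2%:R * (disc3_num / fps_subst 2 disc3).
  have Ud : fps_subst 2 disc3 \is a GRing.unit by rewrite rmorph_unit ?disc3_unit.
  by apply: (mulIr Ud); rewrite schur3_even_sec3 mulrA divrK.
transitivity (coefs (fps_sec 3 2 E) (2 * j + 1)%N); last by rewrite sec3E coefs_natM.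
by congr (coefs _ _); rewrite addn0.
Qed.

(** The first term of [disc3_num] is an even series times phi(q) phi(q^3), whose odd part carries a
    2; in the second, the explicit factor q turns the odd section into an even one. *)
Lemma sec_disc3 : fps_sec 2 1 (disc3_num / fps_subst 2 disc3) * disc3 =
  2%:R * (fps_subst 3 nphi * fps_subst 2 euler * fps_subst 3 psi ^+ 2)
  + 4%:R * (W ^+ 2 * fps_sec 2 0 (phi * om)).
Proof.
have Ud : fps_subst 2 disc3 \is a GRing.unit by rewrite rmorph_unit ?disc3_unit.
rewrite mulrC -(@fps_sec_substM _ 2 1) // mulrCA divrr // mulr1.
have -> : disc3_num = fps_subst 2 (fps_subst 3 nphi * W) * (phi * fps_subst 3 phi)
    + 4%:R * (fps_subst 2 (W ^+ 2) * (q ^+ 1 * (phi * om))).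
  by rewrite /disc3_num rmorphM rmorphXn /= fps_subst_comp // -[(2 * 3)%N]/6%N; ring.
rewrite raddfD /= fps_sec_natM !fps_sec_substM // phi_phi3_odd.
rewrite (@fps_sec_qM _ 2 0 1) //; congr (_ + _).
transitivity (2%:R * (fps_subst 3 nphi * (psi * W) * fps_subst 3 psi)); first by ring.
by rewrite psi_neg_om; ring.
Qed.

(** The exponent 3z^2 + 2z is divisible by 4 for even z and odd for odd z, hence never 2 modulo
    4. *)
Lemma sec_om_even : fps_sec 2 0 om = fps_subst 2 (fps_sec 2 0 (fps_sec 2 0 om)).
Proof.
rewrite {1}[LHS]fps_sec2E; have -> : fps_sec 2 1 (fps_sec 2 0 om) = 0.
  apply: fpsP => n; transitivity (coefs om (2 * (2 * n + 1) + 0)) => //.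
  rewrite (coefs_jtheta_count _ _ (leqnn _)) // count_false // => z; apply/eqP.
  have [w []] : exists w, z = 2 * w \/ z = 2 * w + 1 by exists (z %/ 2)%Z; lia.
    by lia.
  by lia.
by rewrite rmorph0 mulr0 addr0.
Qed.

(** Compare after multiplication by [disc3]. Modulo 4, phi(q) [disc3] is phi(-q^3), because phi(q)
    phi(-q) = phi(-q^2)^2 and phi(-q^3)^2 are both 1; this settles the term with coefficient 2. For
    the term with coefficient 4 it suffices to work modulo 2, where phi and [disc3] are 1 and W^2 is
    W(q^2). Only the evenness of the second term matters afterwards, so z is left unnamed. *)
Lemma sec_disc3_mod8 : exists z : fps int,
  eqm 8 (fps_sec 2 1 (disc3_num / fps_subst 2 disc3))
    (2%:R * (fps_subst 2 (euler * fps_subst 3 psi) * (phi * fps_subst 3 phi))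
     + 4%:R * fps_subst 2 z).
Proof.
exists (W * fps_sec 2 0 (fps_sec 2 0 om)); apply: (eqm_cancel disc3_unit).
rewrite sec_disc3 [X in eqm _ _ X]mulrDl; apply: eqmD.
  rewrite -[X in eqm _ _ X]mulrA; apply: (@eqm_scale 2 4).
  have psi3 : fps_subst 3 psi ^+ 2 = fps_subst 3 phi * fps_subst 6 psi.
    by rewrite -rmorphXn psi_sqr rmorphM /= fps_subst_comp.
  have -> : fps_subst 2 (euler * fps_subst 3 psi) * (phi * fps_subst 3 phi) * disc3
      = (phi * disc3) * (fps_subst 2 euler * fps_subst 3 psi ^+ 2).
    by rewrite psi3 rmorphM /= fps_subst_comp // -[(2 * 3)%N]/6%N; ring.
  rewrite -mulrA; apply: eqmM (eqm_refl _ _); apply: eqm_sym.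
  have [u Du] := eqm2_sq (subst_nphi_eqm2 2); have [v Dv] := eqm2_sq (subst_nphi_eqm2 3).
  rewrite expr1n in Du; rewrite expr1n in Dv.
  exists (fps_subst 3 nphi * (u + v + 4%:R * u * v) - 2%:R * (q * W ^+ 3) * (1 + 4%:R * u)).
  transitivity ((fps_subst 3 nphi * fps_subst 3 nphi ^+ 2 - 8%:R * (q * W ^+ 3)) * (phi * nphi)).
    by rewrite /disc3; ring.
  by rewrite phi_neg_phi Du Dv; ring.
rewrite -[X in eqm _ _ X]mulrA; apply: (@eqm_scale 4 2).
have disc3_1 : eqm 2 disc3 1.
  have [u Du] := subst_nphi_eqm2 3; have [v Dv] := nphi_eqm2.
  rewrite /disc3 Du Dv; exists ((3%:R * u + 6%:R * u ^+ 2 + 4%:R * u ^+ 3 - 4%:R * (q * W ^+ 3))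
     * (1 + 2%:R * v) + v); ring.
apply: eqm_sym; rewrite -[X in eqm _ _ X]mulr1; apply: eqmM disc3_1.
rewrite rmorphM /= -sec_om_even; apply: eqmM.
  exact/eqm_sym/eqm2_frobenius.
rewrite -[X in eqm _ (fps_sec _ _ X) _]mul1r; apply/eqm_sec/eqmM; last exact: eqm_refl.
exact/eqm_sym/phi_eqm2.
Qed.

(** The last extraction leaves 4 f_1 psi(q) psi(q^3)^2 modulo 8, which [euler_psi] turns into 4
    times the square of f_2 psi(q^3); by Frobenius its coefficient at 2k is 4 times the coefficient
    of f_2 psi(q^3) at k. *)
Lemma S3bar_coef m k : (S3bar (8 * m + 1) (2 * (24 * k + 11)) =
  8%:R * coefs (fps_subst 2 euler * fps_subst 3 psi) k %[mod 16])%Z.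
Proof.
rewrite S3bar_mod16.
have -> : (24 * k + 11 = 3 * (2 * (2 * (2 * k) + 1) + 1) + 2)%N by lia.
rewrite schur3_coef; set F := fps_sec 2 1 _.
have FE : eqm 8 (fps_sec 2 1 F) (4%:R * fps_subst 2 (fps_subst 2 euler * fps_subst 3 psi)).
  have [z Fz] := sec_disc3_mod8; apply: eqm_trans (eqm_sec 2 1 Fz) _.
  rewrite raddfD /= !fps_sec_natM fps_sec_substM // fps_sec_subst // mulr0n mulr0 addr0.
  rewrite phi_phi3_odd.
  have -> : 2%:R * (euler * fps_subst 3 psi * (2%:R * (psi * fps_subst 3 psi)))
     = 4%:R * (fps_subst 2 euler * fps_subst 3 psi) ^+ 2.
    by rewrite exprMn -euler_psi; ring.
  exact: (@eqm_scale 4 2 _ _ (eqm2_frobenius _)).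
have := eqm_coefs (2 * k) (@eqm_scale 2 8 _ _ FE).
by rewrite !coefs_natM coefs_substM // mulrA.
Qed.

(** * The quadratic form [2x^2 + 9y^2] *)

(** The exponents are j(3j - 1)/2 and j(3j + 1)/2, giving x = 6j - 1 and x = 6j + 1. *)
Lemma euler_support n : coefs euler n != 0 -> exists x : int, 24 * n%:Z + 1 = x ^+ 2.
Proof.
rewrite euler_pentagonal => nz.
have [j] : exists j, n = jexp 1 2 j \/ n = jexpN 1 2 j.
  case: (n =P 0) => [-> | /eqP n0]; first by exists 0; left.
  move: nz; rewrite /= (negbTE n0) add0r => nz.
  have [j Pj | none] := pickP [pred j : 'I_n | (n == jexp 1 2 j.+1) || (n == jexpN 1 2 j.+1)].
    by exists j.+1; case/orP: Pj => /eqP; [left | right].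
  case/eqP: nz; rewrite big1 // => j _.
  by have /= /norP[/negbTE -> /negbTE ->] := negbT (none j); rewrite addr0 mulr0.
have b2 m : (2 * 'C(m, 2) + m = m * m)%N.
  by case: m => // m; rewrite bin2_double; nia.
have := b2 j; have := b2 j.+1; rewrite /jexp /jexpN.
set u := 'C(_, _); set v := 'C(_, _) => Du Dv [] ->.
  by exists (6 * j%:Z - 1); nia.
by exists (6 * j%:Z + 1); nia.
Qed.

Lemma psi_support n : coefs psi n != 0 -> exists y : int, 8 * n%:Z + 1 = y ^+ 2.
Proof.
rewrite (coefs_psi (leqnn n)) => nz.
have /hasP[z _ /eqP Dn] : has (fun z : int => 2 * z ^+ 2 + z == n%:Z) (zbox n).
  by rewrite has_count lt0n; apply: contraNneq nz => ->.
by exists (4 * z + 1); lia.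
Qed.

Lemma fps_subst_support K (f : fps int) n :
  coefs (fps_subst K f) n != 0 -> exists2 m, n = (K * m)%N & coefs f m != 0.
Proof.
rewrite /=; case: ifP => [/dvdnP[m ->] | _]; last by rewrite eqxx.
case: (posnP K) => [-> | K0]; first by rewrite muln0 div0n => f0; exists 0.
by rewrite mulnK // => fm; exists m; rewrite // mulnC.
Qed.

(** For k = 2a + 3b, 24k + 11 = 2(24a + 1) + 9(8b + 1): this is the origin of the quadratic form. *)
Lemma euler_psi_support k : coefs (fps_subst 2 euler * fps_subst 3 psi) k != 0 ->
  exists x y : int, 24 * k%:Z + 11 = 2 * x ^+ 2 + 9 * y ^+ 2.
Proof.
rewrite coefsM => nz.
have [i nzi | none] := pickP [pred i : 'I_k.+1 |
    coefs (fps_subst 2 euler) i * coefs (fps_subst 3 psi) (k - i) != 0]; last first.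
  by case/eqP: nz; apply: big1 => i _; apply/eqP; have /= := none i => /negbFE.
have : coefs (fps_subst 2 euler) i * coefs (fps_subst 3 psi) (k - i) != 0 by [].
rewrite mulf_eq0 negb_or.
move=> /andP[/fps_subst_support[a Da /euler_support[x Dx]] /fps_subst_support[b Db /psi_support[y Dy]]].
by exists x, y; have := ltn_ord i; lia.
Qed.

Section Inert.
Variable p : nat.
Hypotheses (p_prime : prime p) (p_ge5 : (5 <= p)%N) (inert : legendre (- 18) p = - 1).

Let pdvdM (u v : int) : (p%:Z %| u * v)%Z = (p%:Z %| u)%Z || (p%:Z %| v)%Z.
Proof. by rewrite !dvdzE abszM Euclid_dvdM. Qed.

Let ndvd3 : ~~ (p %| 3)%N.
Proof. by rewrite gtnNdvd // (leq_trans _ p_ge5). Qed.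

(** If x had an inverse u modulo p, then (9yu)^2 = 9u^2 (9y^2) would be congruent to -18 u^2 x^2,
    that is to -18, against the hypothesis. Hence p divides x, then 9y^2, and y since p does not
    divide 3. *)
Lemma inert_dvd (x y : int) : (p%:Z %| 2 * x ^+ 2 + 9 * y ^+ 2)%Z ->
  (p%:Z %| x)%Z /\ (p%:Z %| y)%Z.
Proof.
move=> dvd_p; have dvd_x : (p%:Z %| x)%Z.
  apply/negPn/negP => ndvd_x.
  have : coprimez x p%:Z by rewrite coprimezE coprime_sym prime_coprime // -dvdzE.
  case/coprimezP => [[u v] /= Duv].
  have p0 : p%:Z != 0 by lia.
  pose t := ((9 * y * u) %% p%:Z)%Z.
  have t_lt : (`|t| < p)%N.
    by have := modz_ge0 (9 * y * u) p0; have := @ltz_pmod (9 * y * u) p%:Z; rewrite -/t; lia.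
  move: inert; rewrite /legendre; case: ifP => // _; case: ifPn => [// | noroot _].
  case/negP: noroot; apply/existsP; exists (Ordinal t_lt) => /=.
  have -> : `|t|%N%:Z = t by rewrite gez0_abs // modz_ge0.
  rewrite /t modzXm eqz_mod_dvd.
  have -> : (9 * y * u) ^+ 2 - - 18 =
    9 * u ^+ 2 * (2 * x ^+ 2 + 9 * y ^+ 2) + 18 * (1 + u * x) * (v * p%:Z).
    have -> : v * p%:Z = 1 - u * x by rewrite -Duv; ring.
    by ring.
  by rewrite rpredD // dvdz_mull // dvdz_mull.
split=> //; have : (p%:Z %| 9 * y ^+ 2)%Z.
  have -> : 9 * y ^+ 2 = (2 * x ^+ 2 + 9 * y ^+ 2) - 2 * x * x by ring.
  by rewrite rpredB // dvdz_mull.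
rewrite -[9]/(3 * 3 : int) !pdvdM !orbb => /orP[] //.
by rewrite dvdzE (negbTE ndvd3).
Qed.

(** Descent: p divides x and y, so p^2 cancels; once the exponent is 1, cancelling leaves p dividing
    c. *)
Lemma inert_odd_valuation alpha (c x y : int) : ~~ (p%:Z %| c)%Z ->
  p%:Z ^+ (2 * alpha + 1) * c <> 2 * x ^+ 2 + 9 * y ^+ 2.
Proof.
move=> ndvd_c; have p0 : p%:Z != 0 by lia.
elim: alpha x y => [|a IHa] x y Dc.
all: have [/dvdzP[u Du] /dvdzP[v Dv]] : (p%:Z %| x)%Z /\ (p%:Z %| y)%Z
  by apply: inert_dvd; rewrite -Dc addn1 exprS -mulrA dvdz_mulr.
  case/negP: ndvd_c; apply/dvdzP; exists (2 * u ^+ 2 + 9 * v ^+ 2).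
  by apply: (mulfI p0); rewrite muln0 expr1 in Dc; rewrite Dc Du Dv; ring.
apply: (IHa u v); apply: (mulfI (expf_neq0 2 p0)).
rewrite mulnS in Dc; rewrite mulrA -exprD addnA Dc Du Dv; ring.
Qed.

Lemma prime_sqr_mod24 : (p ^ 2 = 1 %[mod 24])%N.
Proof.
have odd_p : (p %% 2 != 0)%N.
  by rewrite -/(dvdn 2 p) dvdn_prime2 //; lia.
have p3 : (p %% 3 != 0)%N by rewrite -/(dvdn 3 p) dvdn_prime2 //; lia.
have /allP check : all (fun r => [&& r %% 2 != 0 & r %% 3 != 0] ==> (r ^ 2 == 1 %[mod 24]))%N (iota 0 24).
  by [].
apply/eqP; rewrite -modnXm.
by apply: (implyP (check (p %% 24)%N _)); [rewrite mem_iota ltn_mod | lia].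
Qed.

End Inert.

Theorem theorem4p7 (p : nat) (hp : prime p) (hp5 : (5 <= p)%N)
    (hleg : legendre (- 18) p = - 1)
    (m alpha n i : nat) (hi1 : (1 <= i)%N) (hip : (i <= p - 1)%N) :
  (S3bar (8 * m + 1)
     (48 * p ^ (2 * alpha + 2) * n
      + 2 * (24 * i + 11 * p) * p ^ (2 * alpha + 1)) = 0 %[mod 16])%Z.
Proof.
(* The argument is 2 p^(2 alpha + 1) c. Modulo 24, p^(2 alpha + 1) c is 11 p^(2 alpha + 2), that is
   11. *)
pose c := (24 * (p * n + i) + 11 * p)%N.
have [k Dk] : exists k, (p ^ (2 * alpha + 1) * c = 24 * k + 11)%N.
  have sqr_pow : (p ^ (2 * alpha + 2) = 1 %[mod 24])%N.
    have -> : (2 * alpha + 2 = 2 * alpha.+1)%N by lia.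
    by rewrite expnM -modnXm prime_sqr_mod24 // modnXm exp1n.
  exists (p ^ (2 * alpha + 1) * (p * n + i) + 11 * (p ^ (2 * alpha + 2) %/ 24))%N.
  have := divn_eq (p ^ (2 * alpha + 2)) 24; rewrite sqr_pow /c.
  have -> : (p ^ (2 * alpha + 2) = p * p ^ (2 * alpha + 1))%N by rewrite -expnS addnS.
  by set P := (p ^ _)%N => DP; nia.
have -> : (48 * p ^ (2 * alpha + 2) * n + 2 * (24 * i + 11 * p) * p ^ (2 * alpha + 1)
    = 2 * (24 * k + 11))%N.
  have -> : (p ^ (2 * alpha + 2) = p * p ^ (2 * alpha + 1))%N by rewrite -expnS addnS.
  by rewrite -Dk /c; ring.
rewrite S3bar_coef.
case: (coefs (fps_subst 2 euler * fps_subst 3 psi) k =P 0) => [-> | /eqP nz]; first by rewrite mulr0.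
have [x [y Dxy]] := euler_psi_support nz.
(* Modulo p, c is 24i, nonzero because p >= 5 and 0 < i < p. *)
have ndvd_c : ~~ (p%:Z %| c%:Z)%Z.
  rewrite dvdzE -[absz _]/p -[absz _]/c /c (dvdn_addl _ (dvdn_mull 11 (dvdnn p))) Euclid_dvdM // negb_or.
  rewrite (dvdn_addr _ (dvdn_mulr n (dvdnn p))) [X in _ && ~~ X]gtnNdvd ?andbT //; last by lia.
  have -> : 24%N = (2 * (2 * (2 * 3)))%N by [].
  by rewrite !Euclid_dvdM // !gtnNdvd // (leq_trans _ hp5).
case: (@inert_odd_valuation p hp hp5 hleg alpha c x y ndvd_c).
by rewrite -Dxy; lia.
Qed.
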